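(* The following functionals, which each take as input a Baire 2 function $f$ together with its representation (the latter input is suppressed in the notation), are not computable in any $\mathsf{S}^2_k$: (1) any $\Phi:(\mathbb{R}\to\mathbb{R})\to(\mathbb{R}^2\to\mathbb{R})$ such that for Baire 2 $f:[0,1]\to[0,1]$ and its representation, $\Phi(f,p,q)=\sup_{x\in[p,q]}f(x)$ for $p,q\in[0,1]$; (2) any $\Psi:(\mathbb{R}\to\mathbb{R})\to(\mathbb{N}^2\to(\mathbb{R}\to\mathbb{R}))$ such that for Baire 2 $f:[0,1]\to[0,1]$ and its representation, $(\Psi(f,n,m))_{n,m\in\mathbb{N}}$ is a double sequence of continuous functions on $[0,1]$ with $f(x)=\lim_{n\to\infty}\lim_{m\to\infty}\Psi(f,n,m)(x)$ for all $x\in[0,1]$; (3) any $\Xi:(\mathbb{R}\to\mathbb{R})\to((\mathbb{R}\times\mathbb{N})\to\mathbb{N})$ such that for Baire 2 $f:[0,1]\to[0,1]$ and its representation, $\Xi(f)$ is a modulus of continuity for $f$. In particular, each of these functionals computes, together with $\mathsf{S}^2$, a Cantor realiser.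
   Context: Computability is Kleene's S1-S9 computability for total objects of finite type over $\mathbb{N}$ (metatheory ZFC). The partial relation $\{e\}(\vec\Phi)\simeq y$ ($y\in\mathbb{N}$, $\vec\Phi$ a list of finite-type objects) is inductively generated by: S1 successor $x+1$; S2 constants; S3 projection to a number argument; S4 composition $\{e_1\}(\{e_2\}(\vec\Phi),\vec\Phi)$; S5 primitive recursion; S6 permutation of arguments; S7 $\{e\}(f,x,\vec\Phi)=f(x)$ for $f\in\mathbb{N}^{\mathbb{N}}$; S8 $\{e\}(\Psi^{n+2},\vec\Phi)=\Psi(\lambda\xi^{n}.\{e_1\}(\xi,\Psi,\vec\Phi))$ when the inner function is total; S9 $\{e\}(d,\vec\Phi,\vec\Phi')=\{d\}(\vec\Phi)$. A functional is computable in $G$ if, after currying so that values are natural numbers, it equals $\lambda\vec\Phi.\{e\}(G,\vec\Phi)$ for some index $e$. Real numbers are represented by fast-converging Cauchy sequences of rationals (elements of $\mathbb{N}^{\mathbb{N}}$); functions $\mathbb{R}\to\mathbb{R}$ are maps on representations respecting equality of reals, and functions on $[0,1]$ are treated likewise (as inputs of type $\mathbb{R}\to\mathbb{R}$). Subsets of $\mathbb{R}$ are given by characteristic functions, with no further data. $[p,q]$ presupposes $p\le q$. For $k\ge1$, $\mathsf{S}^2_k:\mathbb{N}^{\mathbb{N}}\to\{0,1\}$ decides the truth of $\Sigma^1_k$-formulas (in normal form, with the input $f\in\mathbb{N}^{\mathbb{N}}$ as parameter); e.g. $\mathsf{S}^2=\mathsf{S}^2_1$ satisfies $\mathsf{S}^2(f)=0\leftrightarrow(\exists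 g\in\mathbb{N}^{\mathbb{N}})(\forall n)(f(\overline{g}n)=0)$, with $\overline{g}n$ the code of $(g(0),\dots,g(n-1))$. ''Not computable in any $\mathsf{S}^2_k$'' means that for no $k$ is a functional with the stated property computable in $\mathsf{S}^2_k$. $f:[0,1]\to\mathbb{R}$ is Baire 1 if it is the pointwise limit of a sequence of continuous functions; it is Baire 2 if it is the pointwise limit of a sequence of Baire 1 functions. The representation of a Baire 2 function is such a sequence of Baire 1 functions (with no representation of the individual Baire 1 functions). $C_f$ is the set of points of continuity of $f$. A modulus of continuity for $f$ (where it is assumed that $C_f\neq\emptyset$) is $F:(\mathbb{R}\times\mathbb{N})\to\mathbb{N}$ such that for all $k\in\mathbb{N}$, $x\in C_f$, $y\in[0,1]$: $|x-y|<\frac1{2^{F(x,k)}}\to|f(x)-f(y)|<\frac1{2^k}$. A Cantor realiser is any $\Phi:\big((\mathbb{R}\to\{0,1\})\times(\mathbb{R}\to\mathbb{N})\big)\to\mathbb{R}$ such that $\Phi(A,Y)\in[0,1]\setminus A$ whenever $A\subset[0,1]$ is non-empty and $Y:[0,1]\to\mathbb{N}$ is injective on $A$. *)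

(* Defs.v *)
From mathcomp Require Import all_boot all_order all_algebra.
From mathcomp Require Import all_classical all_reals all_analysis.
Import Order.TTheory GRing.Theory Num.Theory numFieldNormedType.Exports.

Set Implicit Arguments.
Unset Strict Implicit.
Unset Printing Implicit Defensive.

Local Open Scope classical_set_scope.
Local Open Scope ring_scope.

(* Finite types over nat, interpreted by the full function spaces.  Every     *)
(* type has the form s1 ->> ... ->> sn ->> tN, so the objects of finite type  *)
(* are curried functionals with values in nat.                                *)

Inductive ftype : Type := tN | tArr of ftype & ftype.

Declare Scope ftype_scope.
Delimit Scope ftype_scope with ft.
Bind Scope ftype_scope with ftype.
Notation "s ->> t" := (tArr s t) (at level 60, right associativity) : ftype_scope.

Fixpoint interp (s : ftype) : Type :=
  if s is (s1 ->> s2)%ft then interp s1 -> interp s2 else nat.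

Fixpoint args (s : ftype) : seq ftype :=
  if s is (s1 ->> s2)%ft then s1 :: args s2 else [::].

Fixpoint objtuple (l : seq ftype) : Type :=
  if l is s :: l' then (interp s * objtuple l')%type else unit.

Fixpoint apply (s : ftype) : interp s -> objtuple (args s) -> nat :=
  match s with
  | tN => fun x _ => x
  | tArr _ s2 => fun F xi => apply (F xi.1) xi.2
  end.

Definition object : Type := {s : ftype & interp s}.

Definition obj (s : ftype) (x : interp s) : object := existT interp s x.

Definition nobj (n : nat) : object := @obj tN n.

Fixpoint objlist (l : seq ftype) : objtuple l -> seq object :=
  match l with
  | [::] => fun _ => [::]
  | _ :: l' => fun xi => obj xi.1 :: objlist xi.2
  end.

(* Kleene's S1-S9: [kleene e Phi y] is the relation {e}(Phi) ~ y, where the   *)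
(* index e is the number of a finite sequence starting with the number of the *)
(* scheme.  S8 is stated for a functional Psi of any finite type              *)
(* s1 ->> ... ->> sn ->> tN, with one index for each of its n arguments;      *)
(* [kleene_args es L Phi] says that the i-th component of L is the total      *)
(* functional sending xi to {e_i}(xi, Phi), where e_i is the i-th item of es. *)
(* For Psi of pure type n + 2 this is the usual scheme S8.                    *)

Inductive kleene : nat -> seq object -> nat -> Prop :=
| kleene_S1 x Phi : kleene (CodeSeq.code [:: 1%N]) (nobj x :: Phi) x.+1
| kleene_S2 q Phi : kleene (CodeSeq.code [:: 2%N; q]) Phi q
| kleene_S3 x Phi : kleene (CodeSeq.code [:: 3%N]) (nobj x :: Phi) x
| kleene_S4 e1 e2 Phi y z :
    kleene e2 Phi y -> kleene e1 (nobj y :: Phi) z ->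
    kleene (CodeSeq.code [:: 4%N; e1; e2]) Phi z
| kleene_S5_0 e1 e2 Phi y :
    kleene e1 Phi y ->
    kleene (CodeSeq.code [:: 5%N; e1; e2]) (nobj 0 :: Phi) y
| kleene_S5_S e1 e2 x Phi y z :
    kleene (CodeSeq.code [:: 5%N; e1; e2]) (nobj x :: Phi) y ->
    kleene e2 (nobj x :: nobj y :: Phi) z ->
    kleene (CodeSeq.code [:: 5%N; e1; e2]) (nobj x.+1 :: Phi) z
| kleene_S6 e1 (p : seq nat) Phi y :
    perm_eq p (iota 0 (size Phi)) ->
    kleene e1 [seq nth (nobj 0) Phi i | i <- p] y ->
    kleene (CodeSeq.code [:: 6%N, e1 & p]) Phi y
| kleene_S7 (f : interp (tN ->> tN)) x Phi :
    kleene (CodeSeq.code [:: 7%N]) (obj f :: nobj x :: Phi) (f x)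
| kleene_S8 (es : seq nat) (s : ftype) (Psi : interp s)
      (L : objtuple (args s)) Phi :
    kleene_args es L (obj Psi :: Phi) ->
    kleene (CodeSeq.code (8%N :: es)) (obj Psi :: Phi) (apply Psi L)
| kleene_S9 d Phi Phi' y :
    kleene d Phi y ->
    kleene (CodeSeq.code [:: 9%N; size Phi]) (nobj d :: Phi ++ Phi') y
with kleene_args :
    seq nat -> forall l : seq ftype, objtuple l -> seq object -> Prop :=
| kleene_args_nil Phi : @kleene_args [::] [::] tt Phi
| kleene_args_cons e es (s : ftype) (l : seq ftype) (F : interp s)
      (L : objtuple l) Phi :
    (forall xi : objtuple (args s), kleene e (objlist xi ++ Phi) (apply F xi)) ->
    kleene_args es L Phi ->
    @kleene_args (e :: es) (s :: l) (F, L) Phi.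

Definition computable_in (G : seq object) (s : ftype) (F : interp s) : Prop :=
  exists e : nat, forall xi : objtuple (args s),
    kleene e (G ++ objlist xi) (apply F xi).

(* [seqtuple_code [:: a1; ...; ak]] is <a1, <a2, ... ak>>, and a1 if k = 1.   *)
Fixpoint seqtuple_code (s : seq nat) : nat :=
  match s with
  | [::] => 0
  | [:: a] => a
  | a :: s' => CodeSeq.code [:: a; seqtuple_code s']
  end.

(* k alternating function quantifiers, the first one existential if ex holds, *)
(* followed by the dual number quantifier; gs holds the functions already     *)
(* quantified.  With gs empty and ex true this is the Sigma^1_k normal form   *)
(* (exists g1) (forall g2) ... (Q n) f (g1|n, ..., gk|n) = 0.                 *)
Fixpoint analytic_nf (k : nat) (ex : bool) (gs : seq (nat -> nat))
    (f : nat -> nat) : Prop :=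
  match k with
  | 0 =>
      let matrix n :=
        f (seqtuple_code [seq CodeSeq.code (mkseq g n) | g <- gs]) = 0%N in
      if ex then exists n, matrix n else forall n, matrix n
  | k'.+1 =>
      if ex then exists g, analytic_nf k' false (rcons gs g) f
      else forall g, analytic_nf k' true (rcons gs g) f
  end.

Definition S2 (k : nat) : interp ((tN ->> tN) ->> tN) :=
  fun f => if `[< analytic_nf k true [::] f >] then 0%N else 1%N.

(* The rational number (a - b) / (c + 1) for n the code of (a, b, c); missing *)
(* items count as 0.                                                          *)
Definition rat_of_code (R : realType) (n : nat) : R :=
  let s := CodeSeq.decode n in
  ((nth 0%N s 0)%:R - (nth 0%N s 1)%:R) / (nth 0%N s 2).+1%:R.

Definition tR : ftype := tN ->> tN.

Definition represents (R : realType) (a : interp tR) (x : R) : Prop :=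
  (forall n i : nat,
     `|rat_of_code R (a n) - rat_of_code R (a (n + i)%N)| < 2 ^- n) /\
  (rat_of_code R (a n) @[n --> \oo] --> x).

(* A map on representations respects equality of reals iff it represents a    *)
(* function on the reals in the following sense.                              *)
Definition represents_fun (R : realType) (F : interp (tR ->> tR))
    (f : R -> R) : Prop :=
  forall a x, represents a x -> represents (F a) (f x).

Definition represents_natfun (R : realType) (Y : interp (tR ->> tN))
    (y : R -> nat) : Prop :=
  forall a x, represents a x -> Y a = y x.

Definition represents_set (R : realType) (X : interp (tR ->> tN))
    (A : set R) : Prop :=
  represents_natfun X (fun x => nat_of_bool (x \in A)).

Definition unit_itv (R : realType) : set R := `[0, 1].
Arguments unit_itv R : clear implicits.

Definition baire1 (R : realType) (f : R -> R) : Prop :=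
  exists g : nat -> R -> R,
    (forall n, {within unit_itv R, continuous (g n)}) /\
    (forall x, unit_itv R x -> g n x @[n --> \oo] --> f x).

Definition baire2_representation (R : realType) (g : nat -> R -> R)
    (f : R -> R) : Prop :=
  (forall n, baire1 (g n)) /\
  (forall x, unit_itv R x -> g n x @[n --> \oo] --> f x).

Definition continuity_points (R : realType) (f : R -> R) : set R :=
  [set x | unit_itv R x /\ f @ within (unit_itv R) (nbhs x) --> f x].

Definition modulus_of_continuity (R : realType) (m : R -> nat -> nat)
    (f : R -> R) : Prop :=
  forall (k : nat) (x y : R), continuity_points f x -> unit_itv R y ->
    `|x - y| < 2 ^- m x k -> `|f x - f y| < 2 ^- k.

(* In the next three definitions F is the input function and G its            *)
(* representation.  The existence of h expresses that the functional maps     *)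
(* functions on the reals to objects which respect equality of reals.         *)

Definition sup_functional (R : realType)
    (Phi : interp ((tR ->> tR) ->> (tN ->> tR ->> tR) ->> tR ->> tR ->> tR)) :
    Prop :=
  forall (F : interp (tR ->> tR)) (f : R -> R)
         (G : interp (tN ->> tR ->> tR)) (g : nat -> R -> R),
    represents_fun F f -> (forall n, represents_fun (G n) (g n)) ->
    exists h : R -> R -> R,
      (forall a b x y, represents a x -> represents b y ->
         represents (Phi F G a b) (h x y)) /\
      ((forall x, unit_itv R x -> unit_itv R (f x)) ->
       baire2_representation g f ->
       forall p q, unit_itv R p -> unit_itv R q -> p <= q ->
         h p q = sup (f @` `[p, q])).

Definition limit_functional (R : realType)
    (Psi : interp ((tR ->> tR) ->> (tN ->> tR ->> tR) ->>
                   tN ->> tN ->> tR ->> tR)) : Prop :=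
  forall (F : interp (tR ->> tR)) (f : R -> R)
         (G : interp (tN ->> tR ->> tR)) (g : nat -> R -> R),
    represents_fun F f -> (forall n, represents_fun (G n) (g n)) ->
    exists h : nat -> nat -> R -> R,
      (forall n m, represents_fun (Psi F G n m) (h n m)) /\
      ((forall x, unit_itv R x -> unit_itv R (f x)) ->
       baire2_representation g f ->
       (forall n m, {within unit_itv R, continuous (h n m)}) /\
       (forall x, unit_itv R x ->
          exists l : nat -> R,
            (forall n, h n m x @[m --> \oo] --> l n) /\
            (l n @[n --> \oo] --> f x))).

Definition modulus_functional (R : realType)
    (Xi : interp ((tR ->> tR) ->> (tN ->> tR ->> tR) ->> tR ->> tN ->> tN)) :
    Prop :=
  forall (F : interp (tR ->> tR)) (f : R -> R)
         (G : interp (tN ->> tR ->> tR)) (g : nat -> R -> R),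
    represents_fun F f -> (forall n, represents_fun (G n) (g n)) ->
    exists h : R -> nat -> nat,
      (forall a x k, represents a x -> Xi F G a k = h x k) /\
      ((forall x, unit_itv R x -> unit_itv R (f x)) ->
       baire2_representation g f -> continuity_points f !=set0 ->
       modulus_of_continuity h f).

Definition cantor_realiser (R : realType)
    (C : interp ((tR ->> tN) ->> (tR ->> tN) ->> tR)) : Prop :=
  forall (X : interp (tR ->> tN)) (A : set R)
         (Y : interp (tR ->> tN)) (y : R -> nat),
    represents_set X A -> represents_natfun Y y ->
    exists x : R,
      represents (C X Y) x /\
      (A `<=` unit_itv R -> A !=set0 -> {in A &, injective y} ->
       unit_itv R x /\ ~ A x).

(* Main.v *)
Require Import Defs.
From Stdlib Require Import Eqdep.
From mathcomp Require Import all_boot all_order all_algebra.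
From mathcomp Require Import ring lra zify.
From mathcomp Require Import all_classical all_reals all_analysis.
Import Order.TTheory GRing.Theory Num.Theory numFieldNormedType.Exports.

(** Let y be injective on a set A of reals.  The slice {x in A | y x = n} has
    at most one point, so its indicator function is Baire 1, and the constant
    sequence represents it as a Baire 2 function.  A point of [0,1] outside A is
    the limit of nested dyadic intervals, the n-th of which is shrunk so that it
    leaves the n-th slice ([realiser_of_step]).  Each of the three functionals,
    applied to the indicator of the slice, tells how to shrink:
    - the supremum over the left quarter of the interval is 1 or 0, according to
      whether the point of the slice lies there ([sup_step_avoids]);
    - a modulus of continuity at a centre off the slice is a radius within which
      the point of the slice does not lie ([modulus_step_avoids]);
    - if the indicator is lim_i lim_m h_im with h_im continuous, then the point
      lies in the left quarter iff there are binary digits of a real z there and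
      bounds from which on the h_im stay away from 0 near z; the h_im are
      evaluated only at the dyadic approximations of z, so that this is a
      Sigma^1_1 statement about numbers that the functional computes, and S^2
      decides it ([S2_limit_testP]).
    Programs in S1-S9 show that all of this is computable, which gives the
    positive half.

    For the negative half, suppose that such a functional is computable in some
    G of type two.  The realiser built from it depends only on numbers computed
    from G, indicators of slices, constant functions and numbers.  Call a world
    a pair (A, y) with A a part of [0,1], and let D be a partial function from
    [0,1] to the natural numbers.  A number names the real x relative to D if it
    codes an index and arguments of these kinds that compute a representation of
    x in all worlds extending D, or if it is 0 and the realiser answers x in all
    these worlds.  Extending D removes worlds, so it preserves names; and a name
    determines its real, because computations are single-valued.  By Zorn's
    lemma there is a maximal D whose elements are all named by their values, and
    then every named real of [0,1] is in the domain of D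
    ([closed_approximation]).  Now run a computation in the world given by D
    itself.  By induction, every function at which an indicator is evaluated is
    computed alike in all worlds extending D; if it represents a real of [0,1],
    this real is named, hence in the domain of D, where all these worlds agree.
    So the computation has the same result in all of them ([kleene_transfer]).
    In particular the answer of the realiser in the world of D is named by 0,
    and lies in the set that it should avoid ([no_computable_realiser]). *)

Set Implicit Arguments.
Unset Strict Implicit.
Unset Printing Implicit Defensive.

(* Indices are iterated powers of 2, far too large to be computed. *)
Local Opaque CodeSeq.code CodeSeq.decode.

(** * Inversion and uniqueness of Kleene computations *)

Lemma obj_inj (s : ftype) : injective (@obj s).
Proof. exact: inj_pair2. Qed.

Lemma nobj_inj : injective nobj.
Proof. by move=> n m /(@obj_inj tN). Qed.

Lemma nobj_cons_inj x y s t : nobj x :: s = nobj y :: t -> x = y /\ s = t.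
Proof.
move=> eq_st; split; last exact: (congr1 behead eq_st).
exact/nobj_inj/(congr1 (head (nobj 0)) eq_st).
Qed.

Lemma apply_inj (s : ftype) (F F' : interp s) :
  (forall xi, apply F xi = apply F' xi) -> F = F'.
Proof.
elim: s F F' => [|s1 _ s2 IH] F F' eqFF'; first exact: (eqFF' tt).
by apply/funext => x; apply: IH => xi; apply: (eqFF' (x, xi)).
Qed.

Scheme kleene_mind := Minimality for kleene Sort Prop
  with kleene_args_mind := Minimality for kleene_args Sort Prop.

(** What the scheme selected by the decoded index says about a computation.
    Existential equations between lists replace dependent pattern matching on
    objects of varying type. *)
Definition kleene_scheme (l : seq nat) (Phi : seq object) (y : nat) : Prop :=
  match l with
  | [:: 1%N] => exists x T, Phi = nobj x :: T /\ y = x.+1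
  | [:: 2%N; q] => y = q
  | [:: 3%N] => exists x T, Phi = nobj x :: T /\ y = x
  | [:: 4%N; e1; e2] => exists2 z, kleene e2 Phi z & kleene e1 (nobj z :: Phi) y
  | [:: 5%N; e1; e2] => exists x T, Phi = nobj x :: T /\
      if x is x'.+1 then
        exists2 z, kleene (CodeSeq.code l) (nobj x' :: T) z &
          kleene e2 (nobj x' :: nobj z :: T) y
      else kleene e1 T y
  | [:: 6%N, e1 & p] => kleene e1 [seq nth (nobj 0) Phi i | i <- p] y
  | [:: 7%N] => exists (f : interp (tN ->> tN)) x T,
      Phi = obj f :: nobj x :: T /\ y = f x
  | 8%N :: es => exists (s : ftype) (Psi : interp s) (L : objtuple (args s)) T,
      [/\ Phi = obj Psi :: T, kleene_args es L Phi & y = apply Psi L]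
  | [:: 9%N; m] => exists d T, Phi = nobj d :: T /\ kleene d (take m T) y
  | _ => False
  end.

Lemma kleene_inv e Phi y :
  kleene e Phi y -> kleene_scheme (CodeSeq.decode e) Phi y.
Proof.
case=> {e Phi y}; intros; rewrite CodeSeq.codeK /=.
- by exists x, Phi.
- by [].
- by exists x, Phi.
- by exists y.
- by exists 0%N, Phi.
- by exists x.+1, Phi; split=> //; exists y.
- by [].
- by exists f, x, Phi.
- by exists s, Psi, L, Phi.
- by exists d, (Phi ++ Phi'); rewrite take_size_cat.
Qed.

Lemma kleene_args_inv es (l : seq ftype) (L : objtuple l) Phi :
  kleene_args es L Phi ->
  match l return objtuple l -> Prop with
  | [::] => fun _ => True
  | s :: l' => fun L => exists e es', [/\ es = e :: es',
      forall xi, kleene e (objlist xi ++ Phi) (apply L.1 xi)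
      & kleene_args es' L.2 Phi]
  end L.
Proof. by case=> [//|e es' s l' F L' Phi' HF HL]; exists e, es'. Qed.

(** Induction on the first computation; the index determines the scheme used by
    the second one.  In S8 the functionals passed as arguments agree at all
    arguments by induction, hence are equal by extensionality. *)
Lemma kleene_det e Phi y y' : kleene e Phi y -> kleene e Phi y' -> y = y'.
Proof.
move=> H; move: e Phi y H y'.
apply: (@kleene_mind (fun e Phi y => forall y', kleene e Phi y' -> y = y')
  (fun es l L Phi => forall L' : objtuple l, kleene_args es L' Phi -> L = L'))
  => [x Phi|q Phi|x Phi|e1 e2 Phi y z _ IH2 _ IH1|e1 e2 Phi y _ IH
     |e1 e2 x Phi y z _ IHx _ IH|e1 p Phi y _ _ IH|f x Phi|es s Psi L Phi _ IH
     |d Phi Phi' y _ IH|Phi|e es s l F L Phi _ IHF _ IHL] y'.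
- move/kleene_inv; rewrite CodeSeq.codeK /=.
  by case=> x' [T [/nobj_cons_inj[-> _] ->]].
- by move/kleene_inv; rewrite CodeSeq.codeK.
- move/kleene_inv; rewrite CodeSeq.codeK /=.
  by case=> x' [T [/nobj_cons_inj[-> _] ->]].
- by move/kleene_inv; rewrite CodeSeq.codeK /= => -[z' /IH2 <- /IH1].
- move/kleene_inv; rewrite CodeSeq.codeK /=.
  by case=> x' [T [/nobj_cons_inj[<- <-] /IH]].
- move/kleene_inv; rewrite CodeSeq.codeK /=.
  by case=> x' [T [/nobj_cons_inj[<- <-]]] [z' /IHx <- /IH].
- by move/kleene_inv; rewrite CodeSeq.codeK /= => /IH.
- move/kleene_inv; rewrite CodeSeq.codeK /=.
  case=> f' [x' [T [eqPhi ->]]].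
  have /obj_inj-> := congr1 (head (nobj 0)) eqPhi.
  by have /nobj_cons_inj[-> _] := congr1 behead eqPhi.
- move/kleene_inv; rewrite CodeSeq.codeK /=.
  case=> s' [Psi' [L' [T [eqPsi HL' ->]]]].
  have eqs : s = s' := congr1 (fun Theta => tag (head (nobj 0) Theta)) eqPsi.
  have {eqPsi} := congr1 (head (nobj 0)) eqPsi => /=.
  case: _ / eqs Psi' L' HL' => Psi' L' HL' /obj_inj <-.
  by rewrite (IH _ HL').
- move/kleene_inv; rewrite CodeSeq.codeK /=.
  by case=> d' [T [/nobj_cons_inj[<- <-]]]; rewrite take_size_cat // => /IH.
- by case: y'.
- case: y' => F' L' /kleene_args_inv [_ [_ [[<- <-] HF' /IHL ->]]].
  by congr pair; apply: apply_inj => xi; apply: IHF.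
Qed.

(** * Indicators of slices and coded intervals *)

(** The indicator function of {x in A | y x = n} on representations, for X and
    Y representing A and y: the rational number with code 2 is 1, the one with
    code 0 is 0. *)
Definition slices (X Y : interp (tR ->> tN)) (n : nat) : interp (tR ->> tR) :=
  fun a _ => ((X a == 1%N) && (Y a == n)).*2.

Definition entry (i c : nat) : nat := nth 0%N (CodeSeq.decode c) i.

(** The code of the rational number k / 2^j. *)
Definition dyadic_code (k j : nat) : nat := CodeSeq.code [:: k; 0; 2 ^ j - 1]%N.

(** The code of the interval [k / 2^j, (k + 1) / 2^j]. *)
Definition itv_code (k j : nat) : nat := CodeSeq.code [:: k; j].

Lemma entry_itv_code k j :
  (entry 0 (itv_code k j) = k) * (entry 1 (itv_code k j) = j).
Proof. by rewrite /entry /itv_code CodeSeq.codeK. Qed.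

(** The n-th interval obtained from [0,1] when [sel n] replaces the n-th
    interval by the next one. *)
Definition nested (sel : nat -> nat -> nat) (n : nat) : nat :=
  iteri n sel (itv_code 0 0).

Definition nested_rep (sel : nat -> nat -> nat) : interp tR :=
  fun n => dyadic_code (entry 0 (nested sel n)) (entry 1 (nested sel n)).

(** * Programming with the schemes S1-S9 *)

Definition fixed_size (E : Type) (ctx : E -> seq object) : Prop :=
  exists k, forall x, size (ctx x) = k.

(** The objects and the value depend on a parameter ranging over E, while the
    index does not.  The length of the list is constant, because S6 and S9 refer
    to it. *)
Definition computes (E : Type) (ctx : E -> seq object) (h : E -> nat) : Prop :=
  fixed_size ctx /\ exists e, forall x, kleene e (ctx x) (h x).

Lemma computes_reindex E (ctx : E -> seq object) E' (r : E' -> E) (h : E -> nat) :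
  computes ctx h -> computes (ctx \o r) (h \o r).
Proof.
by case=> -[k szk] [e He]; split; [exists k => x; exact: szk
  | exists e => x; exact: He].
Qed.

Lemma computes_const E (ctx : E -> seq object) q :
  fixed_size ctx -> computes ctx (fun=> q).
Proof.
by split=> //; exists (CodeSeq.code [:: 2%N; q]) => x; exact: kleene_S2.
Qed.

Lemma computes_let E (ctx : E -> seq object) (u h : E -> nat) :
  computes ctx u -> computes (fun x => nobj (u x) :: ctx x) h -> computes ctx h.
Proof.
move=> [szc [e2 H2]] [_ [e1 H1]]; split=> //.
by exists (CodeSeq.code [:: 4%N; e1; e2]) => x; apply: kleene_S4 (H1 x).
Qed.

(** Schemes do not ignore trailing arguments in general (S6 permutes the
    whole list), but S9, applied to the constant index e, discards them. *)
Lemma computes_cat E (ctx ctx' : E -> seq object) (h : E -> nat) :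
  fixed_size ctx' -> computes ctx h -> computes (fun x => ctx x ++ ctx' x) h.
Proof.
move=> [k' szk'] [[k szk] [e He]].
split; first by exists (k + k')%N => x; rewrite size_cat szk szk'.
exists (CodeSeq.code [:: 4%N; CodeSeq.code [:: 9%N; k];
  CodeSeq.code [:: 2%N; e]]) => x.
apply: (@kleene_S4 _ _ _ e); first exact: kleene_S2.
by rewrite -(szk x); exact: kleene_S9.
Qed.

Lemma computes_perm E (ctx : E -> seq object) k (p : seq nat) (h : E -> nat) :
  (forall x, size (ctx x) = k) -> perm_eq p (iota 0 k) ->
  computes (fun x => [seq nth (nobj 0) (ctx x) i | i <- p]) h -> computes ctx h.
Proof.
move=> szk pk [_ [e He]]; split; first by exists k.
exists (CodeSeq.code [:: 6%N, e & p]) => x.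
by apply: kleene_S6; rewrite ?szk.
Qed.

(** S6 with the inverse permutation brings the list back into its original
    order. *)
Lemma computes_perm_inv E (ctx : E -> seq object) k (p : seq nat) (h : E -> nat) :
  (forall x, size (ctx x) = k) -> perm_eq p (iota 0 k) ->
  computes ctx h -> computes (fun x => [seq nth (nobj 0) (ctx x) i | i <- p]) h.
Proof.
move=> szk pk [_ [e He]].
have szp : size p = k by rewrite (perm_size pk) size_iota.
have up : uniq p by rewrite (perm_uniq pk) iota_uniq.
split; first by exists k => x; rewrite size_map.
(* The inverse of the permutation p maps j to its position in p. *)
exists (CodeSeq.code [:: 6%N, e & [seq index j p | j <- iota 0 k]]) => x.
apply: kleene_S6.
  rewrite size_map szp perm_sym.
  rewrite -(permPr (perm_map (fun j => index j p) pk)).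
  suff -> : [seq index j p | j <- p] = iota 0 k by [].
  apply: (@eq_from_nth _ 0%N) => [|i]; rewrite size_map ?size_iota // szp => ik.
  by rewrite (nth_map 0%N) ?szp // nth_iota // index_uniq ?szp.
rewrite -map_comp; set s := map _ _.
suff -> : s = ctx x by [].
apply: (@eq_from_nth _ (nobj 0)) => [|j]; rewrite size_map size_iota ?szk //.
move=> jk; rewrite (nth_map 0%N) ?size_iota //= nth_iota // add0n.
have jp : j \in p by rewrite (perm_mem pk) mem_iota.
by rewrite (nth_map 0%N) ?index_mem // nth_index.
Qed.

(** S6 moves the new objects from the front to the end of the list, where
    they can be discarded. *)
Lemma computes_weaken E (ctx : E -> seq object) (h : E -> nat) E' (r : E' -> E)
    (pre : E' -> seq object) :
  fixed_size pre -> computes ctx h ->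
  computes (fun x => pre x ++ ctx (r x)) (fun x => h (r x)).
Proof.
move=> [k' szk'] Hh; have [k szk] := Hh.1.
have szc x : size (pre x ++ ctx (r x)) = (k' + k)%N by rewrite size_cat szk' szk.
apply: (computes_perm szc (p := iota k' k ++ iota 0 k')).
  by rewrite perm_catC -(add0n k') -iotaD.
have -> : (fun x => [seq nth (nobj 0) (pre x ++ ctx (r x)) i |
    i <- iota k' k ++ iota 0 k']) = (fun x => ctx (r x) ++ pre x).
  apply/funext => x; rewrite map_cat; congr (_ ++ _).
    apply: (@eq_from_nth _ (nobj 0)) => [|i]; rewrite size_map size_iota ?szk //.
    move=> ik; rewrite (nth_map 0%N) ?size_iota // nth_iota // nth_cat szk'.
    by rewrite ltnNge leq_addr addKn.
  apply: (@eq_from_nth _ (nobj 0)) => [|i]; rewrite size_map size_iota ?szk' //.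
  move=> ik; rewrite (nth_map 0%N) ?size_iota // nth_iota // nth_cat szk'.
  by rewrite add0n ik.
by apply: (computes_cat (ctx := ctx \o r)) (computes_reindex r Hh); exists k'.
Qed.

Lemma front_perm k i : i < k -> perm_eq (i :: rem i (iota 0 k)) (iota 0 k).
Proof. by move=> ik; rewrite perm_sym perm_to_rem // mem_iota. Qed.

(** A functional is presented by computing its values from its arguments put in
    front of the list; this is how S8 reads its arguments. *)
Definition computes_obj E (ctx : E -> seq object) (s : ftype) (F : E -> interp s) :=
  computes (fun p : E * objtuple (args s) => objlist p.2 ++ ctx p.1)
    (fun p => apply (F p.1) p.2).

Fixpoint computes_args E (ctx : E -> seq object) (l : seq ftype) :
    (E -> objtuple l) -> Prop :=
  match l with
  | [::] => fun _ => True
  | s :: l' => fun L =>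
      computes_obj ctx (fun x => (L x).1) /\
      computes_args ctx (fun x => (L x).2)
  end.

Lemma size_objlist l (xi : objtuple l) : size (objlist xi) = size l.
Proof. by elim: l xi => //= s l IH xi; rewrite IH. Qed.

Lemma computes_var E (ctx : E -> seq object) i n k :
  (forall x, size (ctx x) = k) -> i < k ->
  (forall x, nth (nobj 0) (ctx x) i = nobj (n x)) -> computes ctx n.
Proof.
move=> szk ik nth_i; apply: computes_perm szk (front_perm ik) _ => /=.
split; first by exists (size (i :: rem i (iota 0 k))) => x; rewrite /= size_map.
by exists (CodeSeq.code [:: 3%N]) => x /=; rewrite nth_i; exact: kleene_S3.
Qed.

(** S8 calls the first object of the list only, so Psi is first moved to the
    front; the programs for its arguments then restore the order behind their
    own parameters. *)
Lemma computes_call E (ctx : E -> seq object) (s : ftype) (Psi : E -> interp s)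
    i k (L : E -> objtuple (args s)) :
  (forall x, size (ctx x) = k) -> i < k ->
  (forall x, nth (nobj 0) (ctx x) i = obj (Psi x)) -> computes_args ctx L ->
  computes ctx (fun x => apply (Psi x) (L x)).
Proof.
move=> szk ik nth_i HL; have pk := front_perm ik.
apply: (computes_perm szk pk).
set ctx' := fun x => _.
have {HL}[es Hes] : exists es, forall x, kleene_args es (L x) (ctx' x).
  move: (args s) L HL => l; elim: l => [|s' l IH] L /=.
    by move=> _; exists [::] => x; case: (L x); exact: kleene_args_nil.
  move=> [[_ [e He]] /IH [es Hes]].
  suff [e' He'] : exists e', forall x xi,
      kleene e' (objlist xi ++ ctx' x) (apply (L x).1 xi).
    exists (e' :: es) => x; move: (Hes x) (He' x); case: (L x) => F L' /=.
    by move=> *; apply: kleene_args_cons.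
  pose m := size (args s').
  pose q := iota 0 m ++ [seq (m + j)%N | j <- i :: rem i (iota 0 k)].
  have szq (p : E * objtuple (args s')) :
      size (objlist p.2 ++ ctx p.1) = (m + k)%N.
    by rewrite size_cat size_objlist szk.
  have pq : perm_eq q (iota 0 (m + k)).
    rewrite /q iotaD perm_cat2l add0n.
    have -> : iota m k = [seq (m + j)%N | j <- iota 0 k].
      by rewrite -iotaDl addn0.
    exact: (perm_map (addn m) pk).
  have /(computes_perm_inv szq pq)[_ [e' He']] :
      computes (fun p : E * objtuple (args s') => objlist p.2 ++ ctx p.1)
        (fun p => apply (L p.1).1 p.2).
    by split; [exists (m + k)%N | exists e => -[x xi]; exact: He].
  exists e' => x xi; move: (He' (x, xi)).
  rewrite /= /q map_cat -map_comp.
  set s1 := map _ _; set s2 := map _ _.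
  have -> : s1 = objlist xi.
    apply: (@eq_from_nth _ (nobj 0)) => [|j]; rewrite size_map size_iota.
      by rewrite size_objlist.
    move=> jm; rewrite (nth_map 0%N) ?size_iota // nth_iota // add0n.
    by rewrite nth_cat size_objlist jm.
  have -> : s2 = ctx' x.
    apply: eq_map => j /=.
    by rewrite nth_cat size_objlist ltnNge leq_addr addKn.
  by [].
split; first by exists (size (i :: rem i (iota 0 k))) => x; rewrite size_map.
exists (CodeSeq.code (8%N :: es)) => x.
by move: (Hes x); rewrite /ctx' /= nth_i; exact: kleene_S8.
Qed.

(** Primitive recursion S5, where the step sees the counter, then the previous
    value. *)
Lemma computes_iteri E (ctx : E -> seq object) (u n : E -> nat)
    (st : E -> nat -> nat -> nat) :
  computes ctx u -> computes ctx n ->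
  computes (fun p : E * (nat * nat) => nobj p.2.1 :: nobj p.2.2 :: ctx p.1)
    (fun p => st p.1 p.2.1 p.2.2) ->
  computes ctx (fun x => iteri (n x) (st x) (u x)).
Proof.
move=> Hu Hn [_ [e2 H2]]; apply: computes_let Hn _.
have [[k szk] [e1 H1]] := Hu.
split; first by exists k.+1 => x /=; rewrite szk.
exists (CodeSeq.code [:: 5%N; e1; e2]) => x.
elim: (n x) => [|m IH] /=; first by apply: kleene_S5_0; apply: H1.
by apply: kleene_S5_S IH _; exact: (H2 (x, (m, _))).
Qed.

(** * Arithmetic and sequence coding *)

Lemma computes_ext E (ctx : E -> seq object) (h h' : E -> nat) :
  h =1 h' -> computes ctx h -> computes ctx h'.
Proof. by move=> /funext ->. Qed.

Definition loop_ctx E (ctx : E -> seq object) (p : E * (nat * nat)) :=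
  nobj p.2.1 :: nobj p.2.2 :: ctx p.1.

Lemma fixed_loop_ctx E (ctx : E -> seq object) :
  fixed_size ctx -> fixed_size (loop_ctx ctx).
Proof. by move=> [k szk]; exists k.+2 => p /=; rewrite szk. Qed.

Lemma computes_loop_index E (ctx : E -> seq object) :
  fixed_size ctx -> computes (loop_ctx ctx) (fun p => p.2.1).
Proof.
move=> [k szk]; apply: (@computes_var _ _ 0 _ k.+2) => // p /=.
by rewrite szk.
Qed.

Lemma computes_loop_acc E (ctx : E -> seq object) :
  fixed_size ctx -> computes (loop_ctx ctx) (fun p => p.2.2).
Proof.
move=> [k szk]; apply: (@computes_var _ _ 1 _ k.+2) => // p /=.
by rewrite szk.
Qed.

Lemma computes_loop_weaken E (ctx : E -> seq object) (u : E -> nat) :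
  computes ctx u -> computes (loop_ctx ctx) (fun p => u p.1).
Proof.
apply: (@computes_weaken _ _ _ _ fst (fun p => [:: nobj p.2.1; nobj p.2.2])).
by exists 2.
Qed.

Lemma computes_succ E (ctx : E -> seq object) (u : E -> nat) :
  computes ctx u -> computes ctx (fun x => (u x).+1).
Proof.
move=> Hu; apply: computes_let (Hu) _; have [[k szk] _] := Hu.
split; first by exists k.+1 => x /=; rewrite szk.
by exists (CodeSeq.code [:: 1%N]) => x; exact: kleene_S1.
Qed.

Lemma computes_iter E (ctx : E -> seq object) (u v : E -> nat) (st : E -> nat -> nat) :
  computes ctx u -> computes ctx v ->
  computes (loop_ctx ctx) (fun p => st p.1 p.2.2) ->
  computes ctx (fun x => iter (v x) (st x) (u x)).
Proof.
move=> Hu Hv Hst.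
have := computes_iteri (st := fun x _ => st x) Hu Hv Hst; apply: computes_ext => x.
by elim: (v x) => //= n ->.
Qed.

Lemma computes_pred E (ctx : E -> seq object) (u : E -> nat) :
  computes ctx u -> computes ctx (fun x => (u x).-1).
Proof.
move=> Hu; have szc := Hu.1.
have := computes_iteri (st := fun _ i _ => i) (computes_const 0 szc) Hu
  (computes_loop_index szc).
by apply: computes_ext => x; case: (u x).
Qed.

Lemma computes_add E (ctx : E -> seq object) (u v : E -> nat) :
  computes ctx u -> computes ctx v -> computes ctx (fun x => u x + v x).
Proof.
move=> Hu Hv; have szc := Hu.1.
have := computes_iter (st := fun _ => succn) Hu Hv
  (computes_succ (computes_loop_acc szc)).
by apply: computes_ext => x; rewrite iter_succn.
Qed.

Lemma computes_sub E (ctx : E -> seq object) (u v : E -> nat) :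
  computes ctx u -> computes ctx v -> computes ctx (fun x => u x - v x).
Proof.
move=> Hu Hv; have szc := Hu.1.
have := computes_iter (st := fun _ => predn) Hu Hv
  (computes_pred (computes_loop_acc szc)).
by apply: computes_ext => x; rewrite iter_predn.
Qed.

Lemma computes_mul E (ctx : E -> seq object) (u v : E -> nat) :
  computes ctx u -> computes ctx v -> computes ctx (fun x => u x * v x).
Proof.
move=> Hu Hv; have szc := Hu.1.
have := computes_iter (st := fun x r => r + u x) (computes_const 0 szc) Hv
  (computes_add (computes_loop_acc szc) (computes_loop_weaken Hu)).
apply: computes_ext => x; elim: (v x) => [|n /= ->]; first by rewrite muln0.
by rewrite mulnS addnC.
Qed.

Lemma computes_double E (ctx : E -> seq object) (u : E -> nat) :
  computes ctx u -> computes ctx (fun x => (u x).*2).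
Proof.
move=> Hu; apply: computes_ext (computes_add Hu Hu) => x; exact: addnn.
Qed.

Lemma computes_pow2 E (ctx : E -> seq object) (u : E -> nat) :
  computes ctx u -> computes ctx (fun x => 2 ^ u x).
Proof.
move=> Hu; have szc := Hu.1.
have acc := computes_loop_acc szc.
have := computes_iter (st := fun _ r => r + r) (computes_const 1 szc) Hu
  (computes_add acc acc).
by apply: computes_ext => x; elim: (u x) => //= n ->; rewrite expnS mul2n addnn.
Qed.

Lemma computes_leq E (ctx : E -> seq object) (u v : E -> nat) :
  computes ctx u -> computes ctx v -> computes ctx (fun x => (u x <= v x) : nat).
Proof.
move=> Hu Hv; have := computes_sub (computes_const 1 Hu.1) (computes_sub Hu Hv).
by apply: computes_ext => x; rewrite -[(u x <= v x)%N]subn_eq0; case: (u x - v x).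
Qed.

Lemma computes_and E (ctx : E -> seq object) (b b' : E -> bool) :
  computes ctx (fun x => b x : nat) -> computes ctx (fun x => b' x : nat) ->
  computes ctx (fun x => (b x && b' x) : nat).
Proof.
by move=> Hb Hb'; apply: computes_ext (computes_mul Hb Hb') => x; rewrite mulnb.
Qed.

Lemma computes_not E (ctx : E -> seq object) (b : E -> bool) :
  computes ctx (fun x => b x : nat) -> computes ctx (fun x => ~~ b x : nat).
Proof.
move=> Hb; apply: computes_ext (computes_sub (computes_const 1 Hb.1) Hb) => x.
by case: (b x).
Qed.

Lemma computes_eqn E (ctx : E -> seq object) (u v : E -> nat) :
  computes ctx u -> computes ctx v -> computes ctx (fun x => (u x == v x) : nat).
Proof.
move=> Hu Hv; have := computes_and (computes_leq Hu Hv) (computes_leq Hv Hu).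
by apply: computes_ext => x; rewrite eqn_leq.
Qed.

Lemma computes_odd E (ctx : E -> seq object) (u : E -> nat) :
  computes ctx u -> computes ctx (fun x => odd (u x) : nat).
Proof.
move=> Hu; have szc := Hu.1.
have := computes_iter (st := fun _ r => 1 - r) (computes_const 0 szc) Hu
  (computes_sub (computes_const 1 (fixed_loop_ctx szc)) (computes_loop_acc szc)).
by apply: computes_ext => x; elim: (u x) => //= n ->; case: (odd n).
Qed.

Lemma computes_half E (ctx : E -> seq object) (u : E -> nat) :
  computes ctx u -> computes ctx (fun x => (u x)./2).
Proof.
move=> Hu; have szc := Hu.1.
have := computes_iteri (st := fun _ i r => r + odd i) (computes_const 0 szc) Hu
  (computes_add (computes_loop_acc szc) (computes_odd (computes_loop_index szc))).
by apply: computes_ext => x; elim: (u x) => //= n ->; rewrite uphalf_half addnC.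
Qed.

(** The code of k :: s is 2^k (2 c + 1), where c is the code of s. *)
Lemma computes_cons E (ctx : E -> seq object) (u v : E -> nat) :
  computes ctx u -> computes ctx v ->
  computes ctx (fun x => CodeSeq.code (u x :: CodeSeq.decode (v x))).
Proof.
move=> Hu Hv.
have := computes_mul (computes_pow2 Hu) (computes_succ (computes_double Hv)).
by apply: computes_ext => x; rewrite -{1}[v x]CodeSeq.decodeK.
Qed.

(** Written with arithmetic in place of a case distinction, so that it is a
    composition of programs. *)
Definition halve_even (r : nat) : nat := odd r * r + (1 - odd r) * r./2.

Lemma iter_halve_even i n m : odd m ->
  iter i halve_even (2 ^ n * m) = 2 ^ (n - i) * m.
Proof.
move=> om; elim: i => [|i IH]; first by rewrite subn0.
rewrite iterS IH /halve_even; case: (ltnP i n) => [lt_in|le_ni].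
  have -> : 2 ^ (n - i) * m = (2 ^ (n - i.+1) * m).*2.
    by rewrite -(subnSK lt_in) expnS -mulnA mul2n.
  by rewrite odd_double mul0n mul1n doubleK.
rewrite (eqP (le_ni : n - i == 0)) (eqP (leqW le_ni : n - i.+1 == 0)) !mul1n om.
by rewrite [nat_of_bool true * m]mul1n [1 - nat_of_bool true]subnn mul0n addn0.
Qed.

Definition code_tail (c : nat) : nat := CodeSeq.code (behead (CodeSeq.decode c)).

Lemma code_cons k s : CodeSeq.code (k :: s) = 2 ^ k * (CodeSeq.code s).*2.+1.
Proof. by []. Qed.

(** Halving the code 2^k (2 c + 1) of k :: s as long as it is even leaves
    2 c + 1; the code itself is a large enough number of iterations. *)
Lemma code_tail_halve s :
  CodeSeq.code (behead s) = (iter (CodeSeq.code s) halve_even (CodeSeq.code s))./2.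
Proof.
have := CodeSeq.ltn_code s; case: s => [_|k s /= /andP[/ltnW kc _]].
  by rewrite [CodeSeq.code _]/=.
rewrite [X in iter _ _ X]code_cons iter_halve_even /= ?odd_double //.
by rewrite (eqP (kc : k - _ == 0)) mul1n /= uphalf_double.
Qed.

(** For the code 2^k (2 c + 1) of k :: s the iterates of halving are even
    exactly k times. *)
Lemma code_head_halve s :
  head 0 s = \sum_(i < CodeSeq.code s) (~~ odd (iter i halve_even (CodeSeq.code s))).
Proof.
have := CodeSeq.ltn_code s; case: s => [_|k s /= /andP[kc _]].
  by rewrite [CodeSeq.code _]/= big_ord0.
rewrite -(big_mkord xpredT (fun i => ~~ odd (iter i halve_even _) : nat)) /=.
rewrite (big_cat_nat (n := k)) //=; last exact: ltnW.
rewrite [X in X + _](eq_big_nat _ _ (F2 := fun=> 1)); last first.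
  move=> i /andP[_ ik]; rewrite code_cons iter_halve_even /= ?odd_double //.
  by rewrite -(subnSK ik) expnS -mulnA mul2n odd_double.
rewrite sum_nat_const_nat subn0 muln1.
rewrite big_nat_cond big1 ?addn0 // => i /andP[/andP[/eqP ki _] _].
by rewrite code_cons iter_halve_even /= ?odd_double // ki mul1n /= odd_double.
Qed.

Lemma computes_iter_halve E (ctx : E -> seq object) (u v : E -> nat) :
  computes ctx u -> computes ctx v ->
  computes ctx (fun x => iter (v x) halve_even (u x)).
Proof.
move=> Hu Hv; have szc := Hu.1.
have acc := computes_loop_acc szc; have oacc := computes_odd acc.
apply: (computes_iter (st := fun=> halve_even)) => //.
apply: computes_add; first exact: computes_mul oacc acc.
apply: computes_mul; last exact: computes_half acc.
by apply: computes_sub oacc; apply: computes_const; exact: fixed_loop_ctx.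
Qed.

Lemma iteri_sum (f : nat -> nat) n :
  iteri n (fun i r => r + f i) 0 = \sum_(i < n) f i.
Proof. by elim: n => [|n /= ->]; rewrite ?big_ord0 ?big_ord_recr. Qed.

Lemma computes_head_code E (ctx : E -> seq object) (u : E -> nat) :
  computes ctx u ->
  computes ctx (fun x => head 0 (CodeSeq.decode (u x))).
Proof.
move=> Hu; have szc := Hu.1.
pose st x i r := r + ~~ odd (iter i halve_even (u x)).
have Hst : computes (loop_ctx ctx) (fun p => st p.1 p.2.1 p.2.2).
  apply: computes_add; first exact: computes_loop_acc.
  apply: computes_not; apply: computes_odd; apply: computes_iter_halve.
    exact: computes_loop_weaken.
  exact: computes_loop_index.
apply: computes_ext (computes_iteri (computes_const 0 szc) Hu Hst) => x.
by rewrite iteri_sum code_head_halve CodeSeq.decodeK.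
Qed.

Lemma computes_tail_code E (ctx : E -> seq object) (u : E -> nat) :
  computes ctx u ->
  computes ctx (fun x => code_tail (u x)).
Proof.
move=> Hu; apply: computes_ext (computes_half (computes_iter_halve Hu Hu)) => x.
by rewrite /code_tail code_tail_halve CodeSeq.decodeK.
Qed.

Lemma iter_code_tail i c :
  iter i code_tail c = CodeSeq.code (drop i (CodeSeq.decode c)).
Proof.
elim: i => [|i IH] /=; first by rewrite drop0 CodeSeq.decodeK.
by rewrite IH /code_tail CodeSeq.codeK -drop1 drop_drop.
Qed.

Lemma computes_iter_tail E (ctx : E -> seq object) (u v : E -> nat) :
  computes ctx u -> computes ctx v ->
  computes ctx (fun x => iter (v x) code_tail (u x)).
Proof.
move=> Hu Hv; apply: (computes_iter (st := fun=> code_tail)) => //.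
exact/computes_tail_code/computes_loop_acc/Hu.1.
Qed.

Lemma computes_entry E (ctx : E -> seq object) (u v : E -> nat) :
  computes ctx u -> computes ctx v ->
  computes ctx (fun x => entry (v x) (u x)).
Proof.
move=> Hu Hv; apply: computes_ext (computes_head_code (computes_iter_tail Hu Hv)).
by move=> x; rewrite iter_code_tail CodeSeq.codeK -nth0 nth_drop addn0.
Qed.

Lemma code_eq0 s : (CodeSeq.code s == 0) = nilp s.
Proof. by case: s => // k s; rewrite code_cons muln_eq0 expn_eq0. Qed.

(** The length is the number of tails that are not empty, and a list is not
    longer than its code. *)
Lemma computes_size E (ctx : E -> seq object) (u : E -> nat) : computes ctx u ->
  computes ctx (fun x => size (CodeSeq.decode (u x))).
Proof.
move=> Hu; have szc := Hu.1.
pose st x i r := r + (0 < iter i code_tail (u x)).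
have Hst : computes (loop_ctx ctx) (fun p => st p.1 p.2.1 p.2.2).
  apply: computes_add; first exact: computes_loop_acc.
  apply: computes_leq; first by apply: computes_const; exact: fixed_loop_ctx.
  apply: computes_iter_tail; first exact: computes_loop_weaken.
  exact: computes_loop_index.
apply: computes_ext (computes_iteri (computes_const 0 szc) Hu Hst) => x.
set c := u x; have size_le : size (CodeSeq.decode c) <= c.
  rewrite -{2}[c]CodeSeq.decodeK.
  elim: (CodeSeq.decode c) => // k s IH; rewrite code_cons /=.
  apply: leq_ltn_trans IH _.
  have : 0 < 2 ^ k by rewrite expn_gt0.
  by case: (2 ^ k) => // m _; rewrite mulSn; lia.
rewrite -[RHS](minn_idPr size_le).
suff count n : iteri n (st x) 0 = minn n (size (CodeSeq.decode c)) by exact: count.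
elim: n => [|n /= ->]; first by rewrite min0n.
rewrite /st lt0n iter_code_tail code_eq0 /nilp size_drop subn_eq0 -ltnNge -/c; lia.
Qed.

Lemma computes_itv_code E (ctx : E -> seq object) (u v : E -> nat) :
  computes ctx u -> computes ctx v ->
  computes ctx (fun x => itv_code (u x) (v x)).
Proof.
move=> Hu Hv; have nil := computes_const 0 Hu.1.
have := computes_cons Hu (computes_cons Hv nil).
by apply: computes_ext => x; rewrite CodeSeq.codeK.
Qed.

Lemma computes_dyadic_code E (ctx : E -> seq object) (u v : E -> nat) :
  computes ctx u -> computes ctx v ->
  computes ctx (fun x => dyadic_code (u x) (v x)).
Proof.
move=> Hu Hv; have cst n := computes_const n Hu.1.
have := computes_cons Hu (computes_cons (cst 0)
  (computes_cons (computes_sub (computes_pow2 Hv) (cst 1)) (cst 0))).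
by apply: computes_ext => x; rewrite !CodeSeq.codeK.
Qed.

(** Whether the rational number with code c exceeds 1/2, cleared of the
    denominator. *)
Definition above_half (c : nat) : bool :=
  ((entry 1 c).*2 + entry 2 c).+1 < (entry 0 c).*2.

Lemma computes_above_half E (ctx : E -> seq object) (u : E -> nat) :
  computes ctx u ->
  computes ctx (fun x => above_half (u x) : nat).
Proof.
move=> Hu; have f i := computes_entry Hu (computes_const i Hu.1).
apply: computes_leq; last exact/computes_double.
by do 2!apply: computes_succ; apply: computes_add => //; exact: computes_double.
Qed.

(** * Passing functionals as arguments *)

Definition contains E (ctx : E -> seq object) (s : ftype) (Psi : E -> interp s) :=
  exists i k, [/\ forall x, size (ctx x) = k, i < k &
    forall x, nth (nobj 0) (ctx x) i = obj (Psi x)].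

Lemma contains_weaken E (ctx : E -> seq object) E' (r : E' -> E)
    (pre : E' -> seq object) s (Psi : E -> interp s) :
  fixed_size pre -> contains ctx Psi ->
  contains (fun x => pre x ++ ctx (r x)) (fun x => Psi (r x)).
Proof.
move=> [k' szk'] [i [k [szk ik nth_i]]]; exists (k' + i), (k' + k); split.
- by move=> x; rewrite size_cat szk' szk.
- by rewrite ltn_add2l.
- by move=> x; rewrite nth_cat szk' ltnNge leq_addr addKn nth_i.
Qed.

Lemma contains_loop E (ctx : E -> seq object) s (Psi : E -> interp s) :
  contains ctx Psi -> contains (loop_ctx ctx) (fun p => Psi p.1).
Proof.
apply: (@contains_weaken _ _ _ fst (fun p => [:: nobj p.2.1; nobj p.2.2])).
by exists 2.
Qed.

Lemma contains_objlist E (ctx : E -> seq object) l s (Psi : E -> interp s) :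
  contains ctx Psi ->
  contains (fun p : E * objtuple l => objlist p.2 ++ ctx p.1) (fun p => Psi p.1).
Proof.
apply: (@contains_weaken _ _ _ fst (fun p : E * objtuple l => objlist p.2)).
by exists (size l) => p; rewrite size_objlist.
Qed.

Lemma computes_objlist E (ctx : E -> seq object) l (u : E -> nat) :
  computes ctx u ->
  computes (fun p : E * objtuple l => objlist p.2 ++ ctx p.1) (fun p => u p.1).
Proof.
apply: (@computes_weaken _ _ _ _ fst (fun p : E * objtuple l => objlist p.2)).
by exists (size l) => p; rewrite size_objlist.
Qed.

Lemma contains_fixed E (ctx : E -> seq object) s (Psi : E -> interp s) :
  contains ctx Psi -> fixed_size ctx.
Proof. by move=> [i [k [szk _ _]]]; exists k. Qed.

Lemma computes_num E (ctx : E -> seq object) (u : E -> nat) :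
  computes ctx u -> computes_obj (s := tN) ctx u.
Proof. exact: computes_objlist. Qed.

Lemma computes_cst_fun E (ctx : E -> seq object) (u : E -> nat) :
  computes ctx u -> computes_obj (s := tR) ctx (fun x => fun=> u x).
Proof. exact: computes_objlist. Qed.

Lemma contains_objlist_head E (ctx : E -> seq object) s l : fixed_size ctx ->
  contains (fun p : E * objtuple (s :: l) => objlist p.2 ++ ctx p.1)
    (fun p => p.2.1).
Proof.
move=> [k szk]; exists 0, (size l + k).+1; split=> // p /=.
by rewrite size_cat size_objlist szk.
Qed.

Lemma computes_contains E (ctx : E -> seq object) (n : E -> nat) :
  contains (s := tN) ctx n -> computes ctx n.
Proof. by move=> [i [k [szk ik nth_i]]]; exact: computes_var szk ik nth_i. Qed.

Lemma computes_apply E (ctx : E -> seq object) s (Psi : E -> interp s)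
    (L : E -> objtuple (args s)) :
  contains ctx Psi -> computes_args ctx L ->
  computes ctx (fun x => apply (Psi x) (L x)).
Proof. by move=> [i [k [szk ik nth_i]]]; exact: computes_call szk ik nth_i. Qed.

Lemma computes_fun_var E (ctx : E -> seq object) (a : E -> interp tR) :
  contains ctx a -> computes_obj (s := tR) ctx a.
Proof.
move=> Ha; have szc := contains_fixed Ha.
apply: (@computes_apply (E * objtuple (args tR)) _ tR (fun p => a p.1)
  (fun p => p.2) (contains_objlist _ Ha)).
split=> //; apply: (computes_num (u := fun p : E * objtuple (args tR) => p.2.1)).
exact/computes_contains/(@contains_objlist_head _ _ tN [::]).
Qed.

Lemma computes_fun_apply E (ctx : E -> seq object) (X : E -> interp (tR ->> tN))
    (a : E -> interp tR) : contains ctx X -> computes_obj ctx a ->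
  computes ctx (fun x => X x (a x)).
Proof.
by move=> HX Ha; apply: (@computes_apply _ _ _ X (fun x => (a x, tt)) HX).
Qed.

Lemma computes_slice_at E (ctx : E -> seq object)
    (X Y : E -> interp (tR ->> tN)) (n : E -> nat) (a : E -> interp tR) m :
  contains ctx X -> contains ctx Y -> computes ctx n -> computes_obj ctx a ->
  computes ctx (fun x => slices (X x) (Y x) (n x) (a x) (m x)).
Proof.
move=> HX HY Hn Ha; apply: computes_double; apply: computes_and.
  by apply: computes_eqn (computes_const _ Hn.1); exact: computes_fun_apply.
by apply: computes_eqn => //; exact: computes_fun_apply.
Qed.

Lemma computes_slices E (ctx : E -> seq object) (X Y : E -> interp (tR ->> tN))
    (n : E -> nat) : contains ctx X -> contains ctx Y -> computes ctx n ->
  computes_obj ctx (fun x => slices (X x) (Y x) (n x)).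
Proof.
move=> HX HY Hn; have Ha := @contains_objlist_head _ _ tR [:: tN] Hn.1.
pose l : seq ftype := args (tR ->> tR).
have H := computes_slice_at (fun p : E * objtuple l => p.2.2.1) (contains_objlist l HX)
  (contains_objlist l HY) (computes_objlist l Hn) (computes_fun_var Ha).
exact: H.
Qed.

(** A program for one shrinking step is iterated by primitive recursion. *)
Lemma computes_realiser s (Phi : interp s)
    (step : interp (tR ->> tR) -> nat -> nat) :
  (forall E (ctx : E -> seq object) X Y n c, contains ctx (fun=> Phi) ->
     contains ctx (fun=> S2 1) -> contains ctx X -> contains ctx Y ->
     computes ctx n -> computes ctx c ->
     computes ctx (fun x => step (slices (X x) (Y x) (n x)) (c x))) ->
  @computable_in [:: obj Phi; obj (S2 1)] ((tR ->> tN) ->> (tR ->> tN) ->> tR)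
    (fun X Y => nested_rep (fun n => step (slices X Y n))).
Proof.
move=> Hstep.
pose E : Type := objtuple [:: tR ->> tN; tR ->> tN; tN]%ft.
pose ctx (x : E) := [:: obj Phi; obj (S2 1); obj x.1; obj x.2.1; nobj x.2.2.1].
have cPhi : contains ctx (fun=> Phi) by exists 0, 5.
have cS : contains ctx (fun=> S2 1) by exists 1, 5.
have cX : contains ctx (fun x => x.1) by exists 2, 5.
have cY : contains ctx (fun x => x.2.1) by exists 3, 5.
have cn : computes ctx (fun x => x.2.2.1).
  by apply: (@computes_contains E ctx); exists 4, 5.
have szc := cn.1.
have [_ [e He]] : computes ctx (fun x => nested_rep
    (fun n => step (slices x.1 x.2.1 n)) x.2.2.1).
  have Hc : computes ctx (fun x => nested (fun n => step (slices x.1 x.2.1 n)) x.2.2.1).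
    apply: (computes_iteri (st := fun x n => step (slices x.1 x.2.1 n))) => //.
      exact: computes_const.
    exact: (Hstep _ _ _ _ _ _ (contains_loop cPhi) (contains_loop cS)
      (contains_loop cX) (contains_loop cY)
      (computes_loop_index szc) (computes_loop_acc szc)).
  by apply: computes_dyadic_code; apply: computes_entry => //; exact: computes_const.
by exists e => -[X [Y [n []]]]; exact: (He (X, (Y, (n, tt)))).
Qed.

(** * The three shrinking steps as programs *)

(** The points i = 0, ..., 4 divide the interval with code c into
    quarters. *)
Definition subpoint (i c : nat) : nat :=
  dyadic_code (4 * entry 0 c + i) (entry 1 c + 2).

(** The first quarter for b = 0, the last one for b = 1.  Being disjoint, they
    cannot both contain the point of the slice. *)
Definition quarter (b c : nat) : nat :=
  itv_code (4 * entry 0 c + 3 * b) (entry 1 c + 2).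

Lemma computes_subpoint E (ctx : E -> seq object) i (c : E -> nat) :
  computes ctx c -> computes ctx (fun x => subpoint i (c x)).
Proof.
move=> Hc; have cst n := computes_const n Hc.1.
have f n := computes_entry Hc (cst n).
by apply: computes_dyadic_code; apply: computes_add => //; exact: computes_mul.
Qed.

Lemma computes_quarter E (ctx : E -> seq object) (b c : E -> nat) :
  computes ctx b -> computes ctx c ->
  computes ctx (fun x => quarter (b x) (c x)).
Proof.
move=> Hb Hc; have cst n := computes_const n Hc.1.
have f n := computes_entry Hc (cst n).
apply: computes_itv_code; apply: computes_add => //; exact: computes_mul.
Qed.

(** The supremum of the indicator over the first quarter is 0 or 1, so an
    approximation up to 1/4 decides which; the last quarter is chosen if it
    is 1. *)
Definition sup_step
    (Phi : interp ((tR ->> tR) ->> (tN ->> tR ->> tR) ->> tR ->> tR ->> tR))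
    (F : interp (tR ->> tR)) (c : nat) : nat :=
  quarter (above_half
    (Phi F (fun=> F) (fun=> subpoint 0 c) (fun=> subpoint 1 c) 2)) c.

(** The centre k / 2^(j+2) is the point 1, or the point 3 if the point 1 lies
    in the slice (then the indicator has the value code 2 there).  The new
    interval starts at the centre, and its length 2^-(j+h+3) is less than the
    radius 2^-h; it also stays within the quarter to the right of the
    centre. *)
Definition modulus_step
    (Xi : interp ((tR ->> tR) ->> (tN ->> tR ->> tR) ->> tR ->> tN ->> tN))
    (F : interp (tR ->> tR)) (c : nat) : nat :=
  let k := 4 * entry 0 c + 1 + F (fun=> subpoint 1 c) 0 in
  let h := Xi F (fun=> F) (fun=> dyadic_code k (entry 1 c + 2)) 0 in
  itv_code (k * 2 ^ h.+1) (entry 1 c + 2 + h.+1).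

Lemma computes_const_family E (ctx : E -> seq object) (F : E -> interp (tR ->> tR)) :
  fixed_size ctx -> computes_obj ctx F ->
  computes_obj (s := tN ->> tR ->> tR) ctx (fun x => fun=> F x).
Proof.
move=> [k szk] [szF HF].
have Hr := @computes_reindex _ _ _
  (fun p : E * (nat * objtuple (args (tR ->> tR))) => (p.1, p.2.2)) _ (conj szF HF).
by apply: (@computes_weaken _ _ _ _ id
  (fun p : E * (nat * objtuple (args (tR ->> tR))) => [:: nobj p.2.1]) _ Hr); exists 1.
Qed.

Lemma computes_sup_step Phi E (ctx : E -> seq object)
    (X Y : E -> interp (tR ->> tN)) n c : contains ctx (fun=> Phi) ->
  contains ctx X -> contains ctx Y -> computes ctx n -> computes ctx c ->
  computes ctx (fun x => sup_step Phi (slices (X x) (Y x) (n x)) (c x)).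
Proof.
move=> cPhi cX cY Hn Hc; have szc := Hn.1.
have cF := computes_slices cX cY Hn.
apply: computes_quarter => //; apply: computes_above_half.
pose F x := slices (X x) (Y x) (n x).
apply: (@computes_apply _ _ _ (fun=> Phi) (fun x => (F x, (fun=> F x,
  (fun=> subpoint 0 (c x), (fun=> subpoint 1 (c x), (2, tt)))))) cPhi).
split; first exact: cF.
split; first exact: computes_const_family cF.
do 2!(split; first exact/computes_cst_fun/computes_subpoint).
by split=> //; exact/computes_num/computes_const.
Qed.

Lemma computes_modulus_step Xi E (ctx : E -> seq object)
    (X Y : E -> interp (tR ->> tN)) n c : contains ctx (fun=> Xi) ->
  contains ctx X -> contains ctx Y -> computes ctx n -> computes ctx c ->
  computes ctx (fun x => modulus_step Xi (slices (X x) (Y x) (n x)) (c x)).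
Proof.
move=> cXi cX cY Hn Hc; have szc := Hn.1.
have cst k := computes_const k szc; have f k := computes_entry Hc (cst k).
pose F x := slices (X x) (Y x) (n x).
have cF : computes_obj ctx F := computes_slices cX cY Hn.
pose test x := F x (fun=> subpoint 1 (c x)) 0.
have Htest : computes ctx test.
  apply: (computes_slice_at (fun=> 0) cX cY Hn).
  exact/computes_cst_fun/computes_subpoint.
pose k x := 4 * entry 0 (c x) + 1 + test x.
have Hk : computes ctx k.
  by apply: computes_add => //; apply: computes_add => //; exact: computes_mul.
pose l x := entry 1 (c x) + 2.
have Hl : computes ctx l by exact: computes_add.
pose h x := Xi (F x) (fun=> F x) (fun=> dyadic_code (k x) (l x)) 0.
have Hh : computes ctx h.
  apply: (@computes_apply _ _ _ (fun=> Xi) (fun x => (F x, (fun=> F x,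
    (fun=> dyadic_code (k x) (l x), (0, tt))))) cXi).
  split; first exact: cF.
  split; first exact: computes_const_family cF.
  split; first exact: computes_cst_fun (computes_dyadic_code Hk Hl).
  by split=> //; exact: computes_num (cst 0).
apply: computes_itv_code.
  exact: computes_mul Hk (computes_pow2 (computes_succ Hh)).
exact: computes_add Hl (computes_succ Hh).
Qed.

Definition limit_type : ftype :=
  ((tR ->> tR) ->> (tN ->> tR ->> tR) ->> tN ->> tN ->> tR ->> tR)%ft.

(** The number with the l binary digits d 0, ..., d (l-1). *)
Definition binary (d : nat -> bool) (l : nat) : nat :=
  iteri l (fun i r => r.*2 + d i) 0.

(** The approximation by l binary digits of a point of the first quarter of the
    interval with code c. *)
Definition branch_point (d : nat -> bool) (c l : nat) : nat :=
  dyadic_code (4 * entry 0 c * 2 ^ l + binary d l) (entry 1 c + 2 + l).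

(** For sigma the code of g 0, ..., g (l-1), the value is 0 unless sigma refutes
    that g is a witness.  A witness g describes a point z of the first quarter by
    its parities, read as binary digits, and bounds for the limits: for
    n >= g 0, m >= g n and l > g (n + m), the n,m-th continuous function must be
    large at the approximation of z by l digits.  Only one pair n, m is tested
    at each length l, namely the first two items of the list coded by l; every
    pair recurs infinitely often. *)
Definition limit_test (Psi : interp limit_type) (F : interp (tR ->> tR))
    (c sigma : nat) : nat :=
  let l := size (CodeSeq.decode sigma) in
  let n := entry 0 l in
  let m := entry 1 l in
  let g i := entry i sigma in
  let p := branch_point (odd \o g) c l in
  [&& n + m < l, g 0 <= n, g n <= m, g (n + m) < l &
    ~~ above_half (Psi F (fun=> F) n m (fun=> p) 2)].

(** As in [sup_step], with S^2 deciding whether a witness exists. *)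
Definition limit_step (Psi : interp limit_type) (F : interp (tR ->> tR))
    (c : nat) : nat :=
  quarter (S2 1 (limit_test Psi F c) == 0) c.

Lemma eq_binary d d' l : (forall i, i < l -> d i = d' i) -> binary d l = binary d' l.
Proof.
elim: l => // l IH dd'; rewrite /binary /= -/(binary d l) -/(binary d' l).
by rewrite dd' // IH // => i il; apply: dd'; exact: leqW.
Qed.

Lemma computes_limit_test Psi E (ctx : E -> seq object)
    (X Y : E -> interp (tR ->> tN)) n c sigma : contains ctx (fun=> Psi) ->
  contains ctx X -> contains ctx Y -> computes ctx n -> computes ctx c ->
  computes ctx sigma -> computes ctx
    (fun x => limit_test Psi (slices (X x) (Y x) (n x)) (c x) (sigma x)).
Proof.
move=> cPsi cX cY Hn Hc Hs; have szc := Hn.1.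
have cst k := computes_const k szc.
pose F x := slices (X x) (Y x) (n x).
have cF : computes_obj ctx F := computes_slices cX cY Hn.
pose l x := size (CodeSeq.decode (sigma x)).
have Hl : computes ctx l := computes_size Hs.
pose n' x := entry 0 (l x); have Hn' : computes ctx n' := computes_entry Hl (cst 0).
pose m' x := entry 1 (l x); have Hm' : computes ctx m' := computes_entry Hl (cst 1).
have Hg u : computes ctx u -> computes ctx (fun x => entry (u x) (sigma x)).
  by move=> Hu; exact: computes_entry Hs Hu.
have Hbin : computes ctx (fun x => binary (fun i => odd (entry i (sigma x))) (l x)).
  apply: (computes_iteri (st := fun x i r => r.*2 + odd (entry i (sigma x)))
    (cst 0) Hl).
  apply: computes_add; first exact/computes_double/computes_loop_acc.
  apply: computes_odd; apply: computes_entry; last exact: computes_loop_index.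
  exact: computes_loop_weaken.
pose p x := branch_point (odd \o (fun i => entry i (sigma x))) (c x) (l x).
have Hp : computes ctx p.
  have Hf i := computes_entry Hc (cst i).
  apply: computes_dyadic_code.
    have Hk := computes_mul (computes_mul (cst 4) (Hf 0)) (computes_pow2 Hl).
    exact: computes_add Hk Hbin.
  exact: computes_add (computes_add (Hf 1) (cst 2)) Hl.
have Hpsi : computes ctx (fun x => Psi (F x) (fun=> F x) (n' x) (m' x) (fun=> p x) 2).
  apply: (@computes_apply _ _ limit_type (fun=> Psi) (fun x => (F x, (fun=> F x,
    (n' x, (m' x, (fun=> p x, (2, tt))))))) cPsi).
  split; first exact: cF.
  split; first exact: computes_const_family cF.
  split; first exact: computes_num Hn'.
  split; first exact: computes_num Hm'.
  split; first exact: computes_cst_fun Hp.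
  by split=> //; exact: computes_num (cst 2).
have Hnm := computes_add Hn' Hm'.
apply: computes_and; first exact: computes_leq (computes_succ Hnm) Hl.
apply: computes_and; first exact: computes_leq (Hg _ (cst 0)) Hn'.
apply: computes_and; first exact: computes_leq (Hg _ Hn') Hm'.
apply: computes_and; first exact: computes_leq (computes_succ (Hg _ Hnm)) Hl.
exact: computes_not (computes_above_half Hpsi).
Qed.

Lemma computes_limit_step Psi E (ctx : E -> seq object)
    (X Y : E -> interp (tR ->> tN)) n c : contains ctx (fun=> Psi) ->
  contains ctx (fun=> S2 1) ->
  contains ctx X -> contains ctx Y -> computes ctx n -> computes ctx c ->
  computes ctx (fun x => limit_step Psi (slices (X x) (Y x) (n x)) (c x)).
Proof.
move=> cPsi cS cX cY Hn Hc.
apply: computes_quarter => //; apply: computes_eqn; last exact: computes_const Hn.1.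
pose t x := limit_test Psi (slices (X x) (Y x) (n x)) (c x).
apply: (@computes_apply _ _ _ (fun=> S2 1) (fun x => (t x, tt)) cS).
split=> //; pose l : seq ftype := args (tN ->> tN).
have Hs : computes (fun p : E * objtuple l => objlist p.2 ++ ctx p.1) (fun p => p.2.1).
  exact/computes_contains/(@contains_objlist_head _ _ tN [::])/Hn.1.
have H := computes_limit_test (contains_objlist l cPsi) (contains_objlist l cX)
  (contains_objlist l cY) (computes_objlist l Hn) (computes_objlist l Hc) Hs.
exact: H.
Qed.

Local Open Scope classical_set_scope.
Local Open Scope ring_scope.

(** * Cantor realisers elude type-two oracles *)

Lemma represents_unique (R : realType) (a : interp tR) (x x' : R) :
  represents a x -> represents a x' -> x = x'.
Proof. by move=> [_ ax] [_ ax']; apply: cvg_unique ax ax'. Qed.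

Lemma rat_of_code0 (R : realType) : rat_of_code R 0 = 0.
Proof.
have -> : 0%N = CodeSeq.code [::] by [].
by rewrite /rat_of_code CodeSeq.codeK /= subrr mul0r.
Qed.

Lemma represents_cst (R : realType) c : represents (fun=> c) (rat_of_code R c).
Proof.
by split=> [n i|]; [rewrite subrr normr0 invr_gt0 exprn_gt0 | exact: cvg_cst].
Qed.

Section Diagonal.
Variables (R : realType) (G : interp ((tN ->> tN) ->> tN)).

(** A function that represents no real gets the value 0, so that oracles differ
    only at representations. *)
Definition set_functional (A : set R) : interp (tR ->> tN) :=
  fun a => nat_of_bool `[< exists2 x, A x & represents a x >].

Definition natfun_functional (y : R -> nat) : interp (tR ->> tN) :=
  fun a => y (xget 0 [set x | represents a x]).

Lemma set_functionalP A : represents_set (set_functional A) A.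
Proof.
move=> a x ax; rewrite /set_functional; congr nat_of_bool.
apply/asboolP/idP => [[x' Ax' /(represents_unique ax) ->]|/set_mem Ax].
  exact/mem_set.
by exists x.
Qed.

Lemma natfun_functionalP y : represents_natfun (natfun_functional y) y.
Proof.
move=> a x ax; rewrite /natfun_functional; case: xgetP => [x' _ /= ax'|].
  by rewrite (represents_unique ax ax').
by move/(_ x).
Qed.

Definition world_slices (A : set R) (y : R -> nat) :=
  slices (set_functional A) (natfun_functional y).

(** Names for the objects that may occur in the lists of arguments: the fixed
    oracle, the indicators F n and the constant sequences F n, F n, ..., the
    numbers, and the constant functions.  Only these names are countably many and
    independent of the world. *)
Definition realize (F : nat -> interp (tR ->> tR)) (c : nat * nat) : object :=
  match c with
  | (0, _) => obj G
  | (1, n) => obj (F n)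
  | (2, n) => @obj (tN ->> tR ->> tR) (fun=> F n)
  | (3, v) => nobj v
  | (_, v) => @obj tR (fun=> v)
  end.

Lemma realize_nobj F F' c x : realize F c = nobj x -> realize F' c = nobj x.
Proof. by case: c => [[|[|[|[|k]]]] n] //= eq_x; have := congr1 tag eq_x. Qed.

Lemma realize_fun F F' c f : realize F c = @obj tR f -> realize F' c = @obj tR f.
Proof. by case: c => [[|[|[|[|k]]]] n] //= eq_x; have := congr1 tag eq_x. Qed.

Lemma nth_realize F s i :
  nth (nobj 0) (map (realize F) s) i = realize F (nth (3, 0)%N s i).
Proof.
case: (ltnP i (size s)) => si; first exact: nth_map.
by rewrite !nth_default ?size_map.
Qed.

Definition is_tN (s : ftype) := if s is tN then true else false.

Lemma objlist_realize l (xi : objtuple l) : all is_tN l ->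
  exists s, forall F, objlist xi = map (realize F) s.
Proof.
elim: l xi => [|s l IH] xi /=; first by exists [::].
case: s xi => // -[x xi] /= /(IH xi) [s Hs].
by exists ((3, x)%N :: s) => F /=; rewrite -Hs.
Qed.

Definition naming := set (R * nat).

(** The worlds (A, y) in which A contains the domain of D, and y extends D. *)
Definition extends (D : naming) (A : set R) (y : R -> nat) : Prop :=
  A `<=` unit_itv R /\ forall x c, D (x, c) -> A x /\ y x = c.

Definition denotes (D : naming) (e : nat) (s : seq (nat * nat))
    (a : interp tR) : Prop :=
  forall A y, extends D A y -> forall n,
    kleene e (nobj n :: map (realize (world_slices A y)) s) (a n).

(** If a represents a real of [0,1], the value of D there fixes the answers
    of A and y; otherwise a represents no member of either set. *)
Lemma slices_denoted (D : naming) a A y A' y' n m :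
  (forall x, unit_itv R x -> represents a x -> exists c, D (x, c)) ->
  extends D A y -> extends D A' y' ->
  world_slices A y n a m = world_slices A' y' n a m.
Proof.
move=> Da [A1 Dy] [A1' Dy']; rewrite /world_slices /slices.
have [[x x1 ax]|nax] := pselect (exists2 x, unit_itv R x & represents a x).
  have [c Dxc] := Da x x1 ax; have [Ax yx] := Dy _ _ Dxc.
  have [Ax' yx'] := Dy' _ _ Dxc.
  rewrite (set_functionalP A ax) (set_functionalP A' ax).
  rewrite (natfun_functionalP y ax) (natfun_functionalP y' ax) yx yx'.
  by rewrite (mem_set Ax) (mem_set Ax').
have zero B : B `<=` unit_itv R -> set_functional B a = 0%N.
  move=> B1; rewrite /set_functional; case: asboolP => // -[x Bx ax].
  by case: nax; exists x => //; exact: B1.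
by rewrite !zero.
Qed.

Section Transfer.
Variables (D : naming).
Hypothesis Dclosed : forall e s a x, denotes D e s a -> unit_itv R x ->
  represents a x -> exists c, D (x, c).

(** Computations depend on the world only through calls of indicators of
    slices.  By the induction hypothesis, the function at which an indicator is
    called is computed by the same index in all worlds, so it is denoted, and
    the worlds agree at it. *)
Lemma kleene_transfer A0 y0 e s y : extends D A0 y0 ->
  kleene e (map (realize (world_slices A0 y0)) s) y ->
  forall A1 y1, extends D A1 y1 ->
    kleene e (map (realize (world_slices A1 y1)) s) y.
Proof.
move=> D0; set F0 := world_slices A0 y0.
suff kleene_all Phi : kleene e Phi y -> forall s, map (realize F0) s = Phi ->
    forall A1 y1, extends D A1 y1 ->
      kleene e (map (realize (world_slices A1 y1)) s) y.
  by move=> /kleene_all; apply.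
move=> {s}; move: e Phi y.
apply: (@kleene_mind
  (fun e Phi y => forall s, map (realize F0) s = Phi ->
    forall A1 y1, extends D A1 y1 ->
      kleene e (map (realize (world_slices A1 y1)) s) y)
  (fun es l L Phi => forall s, map (realize F0) s = Phi ->
    all (fun t => all is_tN (args t)) l ->
    forall A1 y1, extends D A1 y1 ->
      kleene_args es L (map (realize (world_slices A1 y1)) s)))
  => [x Phi|q Phi|x Phi|e1 e2 Phi y z _ IH2 _ IH1|e1 e2 Phi y _ IH
     |e1 e2 x Phi y z _ IHx _ IH|e1 p Phi y pP _ IH|f x Phi|es t Psi L Phi HL IH
     |d Phi Phi' y _ IH|Phi|e es t l F L Phi _ IHF _ IHL] s eqs.
- case: s eqs => //= c s [/realize_nobj Hc _] A1 y1 _.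
  by rewrite Hc; apply: kleene_S1.
- by move=> A1 y1 _; apply: kleene_S2.
- case: s eqs => //= c s [/realize_nobj Hc _] A1 y1 _.
  by rewrite Hc; apply: kleene_S3.
- move=> A1 y1 D1; apply: kleene_S4 (IH2 _ eqs _ _ D1) _.
  by apply: (IH1 ((3, y)%N :: s)) => //=; rewrite eqs.
- case: s eqs => //= c s [/realize_nobj Hc eqs] A1 y1 D1.
  by rewrite Hc; apply: kleene_S5_0; apply: IH.
- case: s eqs => //= c s [/realize_nobj Hc eqs] A1 y1 D1.
  rewrite Hc; apply: (@kleene_S5_S _ _ _ _ y).
    by apply: (IHx ((3, x)%N :: s)) => //=; rewrite eqs.
  by apply: (IH ((3, x)%N :: (3, y)%N :: s)) => //=; rewrite eqs.
- move=> A1 y1 D1; apply: kleene_S6.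
    by rewrite size_map -(size_map (realize F0)) eqs.
  have -> : [seq nth (nobj 0) [seq realize (world_slices A1 y1) i | i <- s] i
      | i <- p] = map (realize (world_slices A1 y1)) [seq nth (3, 0)%N s i | i <- p].
    by rewrite -map_comp; apply: eq_map => i; rewrite nth_realize.
  apply: IH => //; rewrite -eqs -map_comp.
  by apply: eq_map => i; rewrite nth_realize.
- case: s eqs => //= c1 [//|c2 s] /= [/realize_fun Hf /realize_nobj Hx _] A1 y1 _.
  by rewrite Hf Hx; apply: kleene_S7.
- { case: s eqs => //= c s eqs A1 y1 D1.
  have eqc : realize F0 c = obj Psi := congr1 (head (nobj 0)) eqs.
  have {}IH A' y' (D' : extends D A' y') := IH (c :: s) eqs _ A' y' D'.
  (* a is the argument at which an indicator of a slice is called *)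
  have slicesE e' (a : interp tR) n m :
      (forall A' y', extends D A' y' -> forall xi,
        kleene e' (objlist xi ++ map (realize (world_slices A' y')) (c :: s))
          (apply a xi)) ->
      F0 n a m = world_slices A1 y1 n a m.
    move=> Ha; apply: slices_denoted D0 D1 => x x1 ax.
    apply: (Dclosed (e := e') (s := c :: s)) x1 ax => A' y' D' j.
    exact: (Ha A' y' D' (j, tt)).
  case: c eqc eqs IH slicesE => [[|[|[|[|k]]]] n] /= eqc eqs IH slicesE.
  all: have et := congr1 tag eqc; rewrite /= in et; subst t.
  all: move/obj_inj: eqc => eqc; subst Psi.
  + exact: kleene_S8 (IH isT A1 y1 D1).
  + case: L HL IH => a [m []] _ IH.
    rewrite [apply _ _](_ : _ = apply (world_slices A1 y1 n) (a, (m, tt))).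
      exact: kleene_S8 (IH isT A1 y1 D1).
    have /kleene_args_inv [e' [es' [ees _ _]]] := IH isT _ _ D1.
    apply: (slicesE e') => A' y' D'.
    by have /kleene_args_inv [? [? []]] := IH isT _ _ D'; rewrite ees => -[-> _].
  + case: L HL IH => i [a [m []]] _ IH.
    rewrite [apply _ _](_ : _ = apply (s := tN ->> tR ->> tR)
        (fun=> world_slices A1 y1 n) (i, (a, (m, tt)))).
      exact: kleene_S8 (IH isT A1 y1 D1).
    have /kleene_args_inv [e0 [es0 [ees _]]] := IH isT _ _ D1.
    move=> /kleene_args_inv [e' [es' [ees' _ _]]].
    apply: (slicesE e') => A' y' D'.
    have /kleene_args_inv [? [? []]] := IH isT _ _ D'; rewrite ees => -[_ <- _].
    by move=> /kleene_args_inv [? [? []]]; rewrite ees' => -[-> _].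
  + exact: kleene_S8 (IH isT A1 y1 D1).
  + exact: kleene_S8 (IH isT A1 y1 D1). }
- case: s eqs => //= c s [/realize_nobj Hc eqs] A1 y1 D1; rewrite Hc.
  have eqt : map (realize F0) (take (size Phi) s) = Phi.
    by rewrite map_take eqs take_size_cat.
  rewrite -[s](cat_take_drop (size Phi)) map_cat -[in CodeSeq.code _]eqt.
  move: (IH _ eqt _ _ D1); move: (take _ s) (drop _ s) => s1 s2 Hd.
  by rewrite size_map -(size_map (realize (world_slices A1 y1))); apply: kleene_S9.
- by move=> *; apply: kleene_args_nil.
- move=> /= /andP[Nt Nl] A1 y1 D1; apply: kleene_args_cons; last exact: IHL.
  move=> xi; have [s' Hs'] := objlist_realize xi Nt.
  rewrite (Hs' (world_slices A1 y1)) -map_cat.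
  by apply: IHF => //; rewrite map_cat -Hs' eqs.
Qed.
End Transfer.

Section Closure.
Variable C : (nat -> interp (tR ->> tR)) -> interp tR.

(** The value 0 is reserved for the answer of C; the other numbers code
    programs. *)
Definition named (D : naming) (x : R) (c : nat) : Prop :=
  if c is c'.+1 then
    exists e s a, [/\ c' = pickle (e, s), represents a x & denotes D e s a]
  else forall A y, extends D A y -> represents (C (world_slices A y)) x.

(** By [named_unique], such a D is injective. *)
Definition approximation (D : naming) : Prop :=
  (forall x c c', D (x, c) -> D (x, c') -> c = c') /\
  (forall x c, D (x, c) -> unit_itv R x /\ named D x c).

Definition own_set (D : naming) : set R := [set x | exists c, D (x, c)].

Definition own_code (D : naming) (x : R) : nat := xget 0%N [set c | D (x, c)].

(** The world in which the set is the domain of D and the function extends D. *)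
Lemma own_world (D : naming) :
  approximation D -> extends D (own_set D) (own_code D).
Proof.
move=> [Dfun Dnamed]; split=> [x [c /Dnamed[]]//|x c Dxc].
split; first by exists c.
rewrite /own_code; case: xgetP => [c' _ /= Dxc'|/(_ c) //].
exact: Dfun Dxc' Dxc.
Qed.

(** Both names can be evaluated in the world of D itself. *)
Lemma named_unique (D : naming) x x' c : approximation D ->
  named D x c -> named D x' c -> x = x'.
Proof.
move=> /own_world Dw; case: c => [|c] /=.
  by move=> /(_ _ _ Dw) Cx /(_ _ _ Dw); exact: represents_unique Cx.
move=> [e [s [a [-> ax Ha]]]] [e' [s' [a' [/(pcan_inj pickleK) [<- <-]]]]].
move=> a'x' Ha'; suff eqa : a = a'.
  by rewrite eqa in ax; exact: represents_unique ax a'x'.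
by apply/funext => n; apply: kleene_det (Ha _ _ Dw n) (Ha' _ _ Dw n).
Qed.

Lemma extendsS (D D' : naming) A y :
  D `<=` D' -> extends D' A y -> extends D A y.
Proof. by move=> DD' [A1 Ay]; split=> // x c /DD'; exact: Ay. Qed.

Lemma namedS (D D' : naming) x c : D `<=` D' -> named D x c -> named D' x c.
Proof.
move=> DD'; case: c => [|c] /=.
  by move=> Dx A y /(extendsS DD'); exact: Dx.
move=> [e [s [a [-> ax Ha]]]]; exists e, s, a; split=> // A y /(extendsS DD').
exact: Ha.
Qed.

(** Unions of chains of approximations are approximations, since names persist
    when D grows.  The domain of a maximal D contains all named reals of [0,1]:
    otherwise x with its name c could be added. *)
Lemma closed_approximation : exists D, approximation D /\
  forall x c, unit_itv R x -> named D x c -> exists c', D (x, c').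
Proof.
have [F Fapp Ftot|D [Dapp Dmax]] := @Zorn_bigcup _ approximation.
  split=> [x c c' [D1 FD1 D1x] [D2 FD2 D2x]|x c [D1 FD1 D1x]].
    have [D12|D21] := Ftot _ _ FD1 FD2.
      exact: (Fapp _ FD2).1 (D12 _ D1x) D2x.
    exact: (Fapp _ FD1).1 D1x (D21 _ D2x).
  have [x1 Hx] := (Fapp _ FD1).2 _ _ D1x; split=> //.
  by apply: namedS Hx; exact: bigcup_sup.
exists D; split=> // x c x1 Hx; apply: contrapT => nDx.
have DD' : D `<=` D `|` [set (x, c)] by move=> ? ?; left.
apply: (Dmax (D `|` [set (x, c)])).
  split=> // /(_ (x, c)) D'D; apply: nDx; exists c; apply: D'D; by right.
split=> [x' c1 c2|x' c' [/Dapp.2 [x'1 Hx']|[-> ->]]].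
- move=> [Dc1|[eqx ->]] [Dc2|[eqx' ->]] //.
  + exact: Dapp.1 Dc1 Dc2.
  + by case: nDx; exists c1; rewrite -eqx'.
  + by case: nDx; exists c2; rewrite -eqx.
- by split=> //; exact: namedS Hx'.
- by split=> //; exact: namedS Hx.
Qed.

(** The values T on which C depends are the same in all worlds extending a
    closed D.  Hence so is the answer of C, which is then named by 0.  In the
    world of D this puts the answer into the set to be avoided. *)
Theorem no_computable_realiser (I : Type)
    (T : (nat -> interp (tR ->> tR)) -> I -> nat)
    (d : I -> nat) (s : I -> seq (nat * nat)) :
  (forall X Y i,
    kleene (d i) (map (realize (slices X Y)) (s i)) (T (slices X Y) i)) ->
  (forall F F', T F =1 T F' -> C F = C F') ->
  ~ cantor_realiser R (fun X Y => C (slices X Y)).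
Proof.
move=> HT CT HC; have [D [Dapp Dclosed]] := closed_approximation.
have Dw := own_world Dapp.
have Dcl e t a x : denotes D e t a -> unit_itv R x -> represents a x ->
    exists c, D (x, c).
  move=> Ha x1 ax; apply: (Dclosed x (pickle (e, t)).+1 x1).
  by exists e, t, a.
have [x [Cx xP]] := HC _ _ _ _ (set_functionalP (own_set D))
  (natfun_functionalP (own_code D)).
have [x1 []] : unit_itv R x /\ ~ own_set D x.
  apply: xP; first exact: Dw.1.
    (* The set is not empty, because the index of a constant names the real 0. *)
    have [||c D0] := Dclosed 0
        (pickle (CodeSeq.code [:: 2; 0]%N, [::] : seq (nat * nat))).+1.
    - by rewrite /unit_itv /= in_itv /= lexx ler01.
    - exists (CodeSeq.code [:: 2; 0]%N), [::], (fun=> 0%N); split=> //.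
        by have := represents_cst R 0; rewrite rat_of_code0.
      by move=> A y _ n; exact: kleene_S2.
    by exists 0, c.
  move=> x1 x2 /set_mem [c1 Dc1] /set_mem [c2 Dc2] eqc.
  apply: (named_unique Dapp (Dapp.2 _ _ Dc1).2).
  have [_ e1] := Dw.2 _ _ Dc1; have [_ e2] := Dw.2 _ _ Dc2.
  by rewrite -e1 eqc e2; exact: (Dapp.2 _ _ Dc2).2.
apply: (Dclosed x 0%N x1) => A y Dy.
rewrite (CT _ (world_slices (own_set D) (own_code D))) // => i.
have := kleene_transfer Dcl Dw (HT _ _ i) Dy.
exact: kleene_det (HT _ _ i).
Qed.
End Closure.
End Diagonal.

(** * Nested dyadic intervals *)

Section Intervals.
Variable R : realType.

Definition lower (c : nat) : R := (entry 0 c)%:R / 2 ^+ entry 1 c.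
Definition upper (c : nat) : R := (entry 0 c).+1%:R / 2 ^+ entry 1 c.
Definition coded_itv (c : nat) : set R := `[lower c, upper c].

Lemma pow2_gt0 j : 0 < 2 ^+ j :> R.
Proof. exact: exprn_gt0. Qed.

Lemma rat_of_dyadic_code k j : rat_of_code R (dyadic_code k j) = k%:R / 2 ^+ j.
Proof.
rewrite /rat_of_code /dyadic_code CodeSeq.codeK /= subr0 subn1.
by rewrite prednK ?expn_gt0 // natrX.
Qed.

Definition refines (c c' : nat) : Prop :=
  [/\ (entry 1 c < entry 1 c')%N, lower c <= lower c' & upper c' <= upper c].

Lemma upperE c : upper c = lower c + 2 ^- entry 1 c.
Proof. by rewrite /upper /lower -natr1 mulrDl mul1r. Qed.

(** The limit is the supremum of the left endpoints; the n-th interval has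
    length at most 2^-n. *)
Lemma nested_limit sel : (forall n c, refines c (sel n c)) ->
  exists x, represents (nested_rep sel) x /\
    forall n, coded_itv (nested sel n) x.
Proof.
move=> Hsel; set c := nested sel.
have low_nd m i : lower (c m) <= lower (c (m + i)%N).
  elim: i => [|i IH]; first by rewrite addn0.
  by rewrite addnS; apply: le_trans IH _; have [] := Hsel (m + i)%N (c (m + i)%N).
have up_ni m i : upper (c (m + i)%N) <= upper (c m).
  elim: i => [|i IH]; first by rewrite addn0.
  by rewrite addnS; apply: le_trans IH; have [] := Hsel (m + i)%N (c (m + i)%N).
have lowup i : lower (c i) < upper (c i).
  by rewrite upperE ltrDl invr_gt0 pow2_gt0.
have low_up m i : lower (c m) < upper (c i).
  apply: le_lt_trans (low_nd m i) _; apply: lt_le_trans (lowup _) _.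
  by rewrite addnC.
have level n : (n <= entry 1 (c n))%N.
  elim: n => // n IH; apply: leq_ltn_trans IH _.
  by have [] := Hsel n (c n).
have nd : nondecreasing_seq (lower \o c).
  by move=> m n mn /=; rewrite -(subnKC mn).
have ubd : has_ubound (range (lower \o c)).
  by exists (upper (c 0%N)) => _ [m _ <-]; exact: (ltW (low_up _ _)).
have cl := nondecreasing_cvgn nd ubd; set x := sup _ in cl.
have ratE n : rat_of_code R (nested_rep sel n) = lower (c n).
  exact: rat_of_dyadic_code.
exists x; split; [split|] => [n i||n].
- rewrite !ratE distrC ger0_norm ?subr_ge0 // ltrBlDl.
  apply: lt_le_trans (low_up _ n) _; rewrite upperE lerD2l.
  by rewrite lef_pV2 ?posrE ?pow2_gt0 // ler_eXn2l ?ltr1n.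
- by rewrite (eq_cvg _ _ ratE).
- rewrite /coded_itv /= in_itv /=; apply/andP; split.
    by apply: ub_le_sup => //; exists n.
  apply: ge_sup; first by exists (lower (c 0%N)), 0%N.
  by move=> _ [m _ <-]; exact: (ltW (low_up _ _)).
Qed.

Definition slice (A : set R) (y : R -> nat) (n : nat) : R -> R :=
  fun x => ((x \in A) && (y x == n))%:R.

Lemma rat_of_code2 : rat_of_code R 2 = 1.
Proof.
have -> : 2%N = CodeSeq.code [:: 1%N] by [].
by rewrite /rat_of_code CodeSeq.codeK /= subr0 divr1.
Qed.

Lemma slices_represents X A Y y n : represents_set X A ->
  represents_natfun Y y -> represents_fun (slices X Y n) (slice A y n).
Proof.
move=> XA Yy a x ax; rewrite /slices /slice (XA _ _ ax) (Yy _ _ ax) eqb1.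
case: (_ && _) => /=; first by have := represents_cst R 2; rewrite rat_of_code2.
by have := represents_cst R 0; rewrite rat_of_code0.
Qed.

Lemma slice_unit A y n x : unit_itv R (slice A y n x).
Proof.
by rewrite /unit_itv /slice /= in_itv /= ler0n lern1 leq_b1.
Qed.

(** Injectivity leaves at most one point in a slice. *)
Lemma slice_cases (A : set R) y n : {in A &, injective y} ->
  (exists a, [/\ A a, y a = n & slice A y n = fun x => (x == a)%:R]) \/
  slice A y n = cst 0.
Proof.
move=> yinj; have [[a Aa ya]|nA] := pselect (exists2 a, A a & y a = n).
  left; exists a; split=> //; apply/funext => x; rewrite /slice; congr (_%:R).
  congr nat_of_bool; apply/idP/eqP => [/andP[Ax /eqP yx]|->].
    by apply: yinj => //; [exact/mem_set | rewrite yx].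
  by rewrite ya eqxx andbT; exact/mem_set.
right; apply/funext => x; rewrite /slice /=.
case: (boolP (_ && _)) => // /andP[/set_mem Ax /eqP yx].
by case: nA; exists x.
Qed.

(** The functions 1 / (1 + |x - a|)^n are continuous and converge to the
    indicator function of a. *)
Lemma baire1_point (a : R) : baire1 (fun x => (x == a)%:R).
Proof.
exists (fun n x => (1 + `|x - a|)^-1 ^+ n); split=> [n|x _].
  apply: continuous_subspaceT => x.
  apply: (@continuous_comp _ _ _ (fun x => (1 + `|x - a|)^-1) (fun z => z ^+ n)).
    apply: cvgV; first by rewrite gt_eqF // ltr_pwDl.
    apply: cvgD; first exact: cvg_cst.
    by apply: cvg_norm; apply: cvgB; [exact: cvg_id|exact: cvg_cst].
  exact: exprn_continuous.
have [->|xa] := eqVneq x a.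
  by under eq_fun do rewrite subrr normr0 addr0 invr1 expr1n; exact: cvg_cst.
apply: cvg_expr; rewrite ger0_norm ?invr_ge0 ?addr_ge0 //.
have xa_gt0 : 0 < 1 + `|x - a| by rewrite ltr_pwDl.
by rewrite invf_lt1 // ltrDl normr_gt0 subr_eq0.
Qed.

Lemma baire1_cst (a : R) : baire1 (cst a : R -> R).
Proof.
exists (fun=> cst a); split=> [n|x _]; last exact: cvg_cst.
by apply: continuous_subspaceT => x; exact: cvg_cst.
Qed.

Lemma slice_baire2 A y n : {in A &, injective y} ->
  baire2_representation (fun=> slice A y n) (slice A y n).
Proof.
move=> yinj; split=> [_|x _]; last exact: cvg_cst.
by case: (slice_cases n yinj) => [[a [_ _ ->]]|->];
  [exact: baire1_point | exact: baire1_cst].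
Qed.

(** The limit lies in all the intervals; if it were in A, it would belong to
    the slice numbered by its own value of y, which the corresponding interval
    avoids. *)
Lemma realiser_of_step (step : interp (tR ->> tR) -> nat -> nat) :
  (forall X Y n c, refines c (step (slices X Y n) c)) ->
  (forall X A Y y n c x, represents_set X A -> represents_natfun Y y ->
     {in A &, injective y} -> coded_itv c `<=` unit_itv R ->
     A x -> y x = n -> ~ coded_itv (step (slices X Y n) c) x) ->
  cantor_realiser R (fun X Y => nested_rep (fun n => step (slices X Y n))).
Proof.
move=> Href Hav X A Y y XA Yy; pose sel n := step (slices X Y n).
have Hsel n c : refines c (sel n c) := Href _ _ _ _.
have [x [xrep xin]] := nested_limit Hsel.
have sub01 n : coded_itv (nested sel n) `<=` unit_itv R.
  elim: n => [|n IH].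
    by rewrite /coded_itv /lower /upper /= !entry_itv_code expr0 mul0r divr1.
  apply: subset_trans IH => z; rewrite /coded_itv /= !in_itv /=.
  have [_ lo up] := Hsel n (nested sel n).
  by move=> /andP[/(le_trans lo) -> /le_trans]; exact.
exists x; split=> // A1 A0 yinj; split; first exact: sub01 (xin 0%N).
move=> Ax; apply: (Hav _ _ _ _ (y x) (nested sel (y x)) x XA Yy yinj) => //.
exact: (xin (y x).+1).
Qed.

End Intervals.

(** * Avoiding a slice by suprema or by moduli *)

Section Geometry.
Variable R : realType.

Lemma represents_err (a : interp tR) (x : R) n :
  represents a x -> `|rat_of_code R (a n) - x| <= 2 ^- n.
Proof.
move=> [acau ax]; have cv : `|rat_of_code R (a n) - rat_of_code R (a i)| @[i --> \oo]
    --> `|rat_of_code R (a n) - x|.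
  by apply: cvg_norm; apply: cvgB => //; exact: cvg_cst.
rewrite -(cvg_lim _ cv) //; apply: limr_le; first by apply/cvg_ex; eexists; exact: cv.
by near=> i; rewrite -(@subnKC n i) ?(ltW (acau _ _)) //; near: i; exact: nbhs_infty_ge.
Unshelve. all: by end_near.
Qed.

(** Multiply by twice the denominator. *)
Lemma above_halfP c : above_half c = (2^-1 < rat_of_code R c).
Proof.
rewrite /above_half /rat_of_code /entry; set s := CodeSeq.decode c.
set a := nth _ s 0; set b := nth _ s 1; set d := nth _ s 2.
rewrite ltr_pdivlMr ?ltr0n // -(ltr_pM2l (ltr0n R 2)) mulrA divff // mul1r.
by rewrite mulrBr ltrBrDl -!natrM -natrD ltr_nat -!mul2n addnS.
Qed.

Definition sub_at (i c : nat) : R := (4 * entry 0 c + i)%:R / 2 ^+ (entry 1 c + 2).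

Lemma subpoint_represents i c : represents (fun=> subpoint i c) (sub_at i c).
Proof. by have := represents_cst R (subpoint i c); rewrite rat_of_dyadic_code. Qed.

Lemma sub_atE i c : sub_at i c = lower R c + i%:R / 4 / 2 ^+ entry 1 c.
Proof.
rewrite /sub_at /lower exprD natrD natrM; field.
exact: lt0r_neq0 (pow2_gt0 R _).
Qed.

Lemma lower_quarter b c : lower R (quarter b c) = sub_at (3 * b)%N c.
Proof. by rewrite /lower /quarter !entry_itv_code. Qed.

Lemma upper_quarter b c : upper R (quarter b c) = sub_at (3 * b).+1%N c.
Proof. by rewrite /upper /quarter !entry_itv_code -addnS. Qed.

Lemma sub_at_le i i' c : (i <= i')%N -> sub_at i c <= sub_at i' c.
Proof.
move=> ii'; rewrite /sub_at ler_pM2r ?invr_gt0 ?pow2_gt0 //.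
by rewrite ler_nat leq_add2l.
Qed.

Lemma sub_at_lt i i' c : (i < i')%N -> sub_at i c < sub_at i' c.
Proof.
move=> ii'; rewrite /sub_at ltr_pM2r ?invr_gt0 ?pow2_gt0 //.
by rewrite ltr_nat ltn_add2l.
Qed.

Lemma sub_at0 c : sub_at 0 c = lower R c.
Proof. by rewrite sub_atE !mul0r addr0. Qed.

Lemma sub_at4 c : sub_at 4 c = upper R c.
Proof. by rewrite sub_atE divff // mul1r upperE. Qed.

Lemma refines_quarter (b : bool) c : refines R c (quarter b c).
Proof.
split; first by rewrite /quarter entry_itv_code addn2.
  by rewrite lower_quarter -sub_at0 sub_at_le.
by rewrite upper_quarter -sub_at4 sub_at_le //; case: b.
Qed.

Lemma quarter_avoids (b : bool) c (x : R) :
  b = (x \in `[sub_at 0 c, sub_at 1 c]) -> ~ @coded_itv R (quarter b c) x.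
Proof.
rewrite /coded_itv /= !in_itv /= lower_quarter upper_quarter.
case: b => [/esym/andP[_ x1]|/esym/negP //].
have : sub_at 1 c < sub_at (3 * true)%N c by apply: sub_at_lt.
by move=> /(le_lt_trans x1) x3 /andP[/le_lt_trans/(_ x3)]; rewrite ltxx.
Qed.

Lemma sub_at_unit i c : @coded_itv R c `<=` unit_itv R -> (i <= 4)%N ->
  unit_itv R (sub_at i c).
Proof.
move=> c01 i4; apply: c01; rewrite /coded_itv /= in_itv /=.
by rewrite -sub_at0 -sub_at4 !sub_at_le.
Qed.

Lemma lower_shrunk k j h : lower R (itv_code (k * 2 ^ h) (j + h)) = k%:R / 2 ^+ j.
Proof.
by rewrite /lower !entry_itv_code natrM natrX exprD invfM mulrACA divff ?mulr1 //.
Qed.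

Lemma upper_shrunk k j h : upper R (itv_code (k * 2 ^ h) (j + h))
  = k%:R / 2 ^+ j + 2 ^- (j + h).
Proof. by rewrite upperE lower_shrunk entry_itv_code. Qed.

(** The new interval starts at the i-th subdivision point and has length
    2^-(j+2+h+1), at most a quarter of the interval. *)
Lemma refines_shrunk i c h : (i < 4)%N ->
  refines R c (itv_code ((4 * entry 0 c + i) * 2 ^ h.+1) (entry 1 c + 2 + h.+1)).
Proof.
move=> i4; split; first by rewrite entry_itv_code; lia.
  by rewrite lower_shrunk -sub_at0; exact: sub_at_le.
rewrite upper_shrunk -sub_at4; apply: le_trans (sub_at_le c i4).
rewrite /sub_at (addnS _ i) -[in leRHS]natr1 mulrDl lerD2l mul1r.
by rewrite lef_pV2 ?posrE ?pow2_gt0 // ler_eXn2l ?ltr1n // leq_addr.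
Qed.

Lemma refines_modulus_step Xi X Y n c :
  refines R c (modulus_step Xi (slices X Y n) c).
Proof.
rewrite /modulus_step -addnA; apply: refines_shrunk.
by rewrite /slices; case: (_ && _).
Qed.

End Geometry.

Section Avoidance.
Variable R : realType.
Variables (X Y : interp (tR ->> tN)) (A : set R) (y : R -> nat) (n c : nat) (x : R).
Hypotheses (XA : represents_set X A) (Yy : represents_natfun Y y)
  (yinj : {in A &, injective y}) (c01 : @coded_itv R c `<=` unit_itv R)
  (Ax : A x) (yx : y x = n).
Local Notation f := (slice A y n).

Lemma slice_at z : f z = (z == x)%:R.
Proof.
rewrite /slice; congr (_%:R); congr nat_of_bool.
apply/idP/eqP => [/andP[Az /eqP yz]|->].
  by apply: yinj; rewrite ?yx //; exact/mem_set.
by rewrite yx eqxx andbT; exact/mem_set.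
Qed.

Lemma sup_slice p q : p <= q -> sup (f @` `[p, q]) = (x \in `[p, q])%:R.
Proof.
move=> pq; case: (boolP (x \in `[p, q])) => [xpq|xNpq].
  have ub1 : ubound (f @` `[p, q]) 1.
    by move=> _ [z _ <-]; rewrite slice_at; case: (z == x).
  have f1 : (f @` `[p, q]) 1 by exists x => //; rewrite slice_at eqxx.
  apply/eqP; rewrite eq_le; apply/andP; split.
    by apply: ge_sup => //; exists 1.
  by apply: ub_le_sup => //; exists 1.
suff -> : f @` `[p, q] = [set 0] by rewrite sup1.
apply/seteqP; split=> [_ [z zpq <-]|_ ->].
  by rewrite slice_at /=; case: eqP zpq => // -> /= /(negP xNpq).
exists p; first by rewrite /= in_itv /= lexx.
rewrite slice_at; case: eqP xNpq => // <-; by rewrite in_itv /= lexx pq.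
Qed.

Lemma sup_step_avoids Phi : sup_functional R Phi ->
  ~ @coded_itv R (sup_step Phi (slices X Y n) c) x.
Proof.
move=> HPhi; apply: quarter_avoids.
have Frep := slices_represents n XA Yy.
have [h [Hh /(_ (fun z _ => slice_unit _ _ _ _) (slice_baire2 n yinj)) Hsup]] :=
  HPhi _ _ _ _ Frep (fun=> Frep).
have /(represents_err 2) := Hh _ _ _ _ (subpoint_represents R 0 c)
  (subpoint_represents R 1 c).
rewrite Hsup; [|exact: sub_at_unit|exact: sub_at_unit|exact: sub_at_le].
rewrite sup_slice ?sub_at_le //.
rewrite (above_halfP R); set r := rat_of_code R _.
have -> : 2 ^- 2 = 4^-1 :> R by rewrite -natrX.
rewrite ler_distl; case: (_ \in _) => /andP[]; rewrite ?mulr1n ?mulr0n => rlo rhi.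
  lra.
by apply/negbTE; rewrite -leNgt; lra.
Qed.

(** The indicator of the slice vanishes near z. *)
Lemma slice_continuous z : unit_itv R z -> z != x -> continuity_points f z.
Proof.
move=> z1 zx; split=> //; apply: cvg_within_filter.
have -> : f z = 0 by rewrite slice_at (negbTE zx).
apply: cvg_near_cst; near=> t; rewrite slice_at.
have /negbTE-> // : t != x; near: t.
exact: (open_nbhs_nbhs (conj (@open_neq R x) zx)).
Unshelve. all: by end_near.
Qed.

Lemma slices_test i : slices X Y n (fun=> subpoint i c) 0 = (sub_at R i c == x).*2.
Proof.
have irep := subpoint_represents R i c.
rewrite /slices (XA irep) (Yy irep) eqb1; congr (nat_of_bool _).*2.
apply/idP/eqP => [/andP[/set_mem Az /eqP yz]|->].
  by apply: yinj; rewrite ?yx //; exact/mem_set.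
by rewrite yx eqxx andbT; exact/mem_set.
Qed.

Lemma modulus_step_avoids Xi : modulus_functional R Xi ->
  ~ @coded_itv R (modulus_step Xi (slices X Y n) c) x.
Proof.
move=> HXi; rewrite /modulus_step slices_test.
set b := sub_at R 1 c == x; set i := (1 + b.*2)%N.
have -> : (4 * entry 0 c + 1 + b.*2 = 4 * entry 0 c + i)%N by rewrite addnA.
rewrite -/(subpoint i c) /=.
have ix : sub_at R i c != x.
  rewrite /i /b; case: (eqVneq (sub_at R 1 c) x) => //= <-.
  by rewrite gt_eqF // sub_at_lt.
have i1 : unit_itv R (sub_at R i c) by apply: sub_at_unit => //; rewrite /i; case: (b).
have Frep := slices_represents n XA Yy.
have [m [Hm /(_ (fun z _ => slice_unit _ _ _ _) (slice_baire2 n yinj)) Hmod]] :=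
  HXi _ _ _ _ Frep (fun=> Frep).
rewrite (Hm _ _ 0%N (subpoint_represents R i c)).
move=> xin; have x1 : unit_itv R x.
  apply: c01; move: xin; rewrite /coded_itv /= !in_itv /=.
  have i4 : (i < 4)%N by rewrite /i; case: (b).
  have [_ lo up] := refines_shrunk R c (m (sub_at R i c) 0%N) i4.
  by move=> /andP[/(le_trans lo) -> /le_trans]; exact.
have ic := slice_continuous i1 ix.
have ne : continuity_points f !=set0 by exists (sub_at R i c).
have close : `|sub_at R i c - x| < 2 ^- m (sub_at R i c) 0%N.
  move: xin; rewrite /coded_itv /= in_itv /= lower_shrunk upper_shrunk.
  rewrite -/(sub_at R i c) => /andP[rx xr].
  rewrite distrC ger0_norm ?subr_ge0 // ltrBlDl.
  apply: le_lt_trans xr _; rewrite ltrD2l.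
  by rewrite ltf_pV2 ?posrE ?pow2_gt0 // ltr_eXn2l ?ltr1n; lia.
have := Hmod ne 0%N _ _ ic x1 close.
by rewrite !slice_at eqxx (negbTE ix) sub0r normrN1 expr0 invr1 ltxx.
Qed.
End Avoidance.

(** * Avoiding a slice by double limits *)

Section Analysis.
Variable R : realType.

Lemma binaryS d l : binary d l.+1 = ((binary d l).*2 + d l)%N.
Proof. by []. Qed.

Lemma half_step (k l : nat) : k.*2%:R / 2 ^+ l.+1 = k%:R / 2 ^+ l :> R.
Proof.
rewrite -muln2 natrM exprSr; field.
exact: lt0r_neq0 (pow2_gt0 R l).
Qed.

(** Digits are found greedily: the next one is 1 iff the midpoint of the
    current interval is at most u. *)
Lemma binary_expansion (u : R) : 0 <= u <= 1 -> exists d, forall l,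
  (binary d l)%:R / 2 ^+ l <= u <= (binary d l).+1%:R / 2 ^+ l.
Proof.
move=> /andP[u0 u1].
pose fix D l : nat := if l is l'.+1 then
  ((D l').*2 + ((D l').*2.+1%:R / 2 ^+ l <= u)%R)%N else 0%N.
exists (fun l => (D l).*2.+1%:R / 2 ^+ l.+1 <= u) => l.
have -> : binary (fun l => (D l).*2.+1%:R / 2 ^+ l.+1 <= u) l = D l.
  by elim: l => // l; rewrite binaryS => ->.
elim: l => [|l /andP[IH1 IH2]]; first by rewrite /= mul0r expr0 divr1 u0.
rewrite [D _]/=; case: (leP ((D l).*2.+1%:R / 2 ^+ l.+1) u) => [lo|hi].
  rewrite -[nat_of_bool true]/1%N addn1 lo /=; apply: le_trans IH2 _.
  by rewrite -half_step doubleS.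
by rewrite -[nat_of_bool false]/0%N addn0 half_step IH1 ltW.
Qed.

Lemma binary_bracket (d : nat -> bool) : exists u : R, forall l,
  (binary d l)%:R / 2 ^+ l <= u <= (binary d l).+1%:R / 2 ^+ l.
Proof.
(* Each digit selects a half of the current interval. *)
pose sel i c := itv_code (2 * entry 0 c + d i) (entry 1 c).+1.
have [i c|u [_ Hu]] := @nested_limit R sel.
  split; first by rewrite entry_itv_code.
    rewrite /lower /sel !entry_itv_code -half_step ler_pM2r ?invr_gt0 ?pow2_gt0 //.
    by rewrite ler_nat -mul2n leq_addr.
  rewrite /upper /sel !entry_itv_code -[leRHS]half_step.
  rewrite ler_pM2r ?invr_gt0 ?pow2_gt0 // ler_nat.
  by case: (d i); lia.
exists u => l; have := Hu l; rewrite /coded_itv /= in_itv /= /lower /upper.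
suff -> : nested sel l = itv_code (binary d l) l by rewrite !entry_itv_code.
elim: l => // l; rewrite binaryS /nested /= => ->.
by rewrite /sel !entry_itv_code mul2n.
Qed.

Lemma binary_cvg (d : nat -> bool) (u : R) :
  (forall l, (binary d l)%:R / 2 ^+ l <= u <= (binary d l).+1%:R / 2 ^+ l) ->
  (binary d l)%:R / 2 ^+ l @[l --> \oo] --> u.
Proof.
move=> Hu; apply: (@squeeze_cvgr _ _ _ _ (fun l => u - 2^-1 ^+ l) (fun=> u)).
- near=> l; have /andP[-> +] := Hu l; rewrite andbT lerBlDr.
  by rewrite -natr1 mulrDl mul1r exprVn.
- rewrite -[X in _ --> X]subr0; apply: cvgB; first exact: cvg_cst.
  by apply: cvg_expr; rewrite ger0_norm ?invr_ge0 // invf_lt1 // ltr1n.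
- exact: cvg_cst.
Unshelve. all: by end_near.
Qed.

Definition branch_at (d : nat -> bool) (c l : nat) : R :=
  sub_at R 0 c + (binary d l)%:R / 2 ^+ l / 2 ^+ (entry 1 c + 2).

Lemma branch_represents d c l :
  represents (fun=> branch_point d c l) (branch_at d c l).
Proof.
have := represents_cst R (branch_point d c l); rewrite rat_of_dyadic_code.
suff -> : branch_at d c l = (4 * entry 0 c * 2 ^ l + binary d l)%:R
    / 2 ^+ (entry 1 c + 2 + l) by [].
rewrite /branch_at /sub_at addn0 natrD !natrM natrX !exprD; field.
by rewrite !(lt0r_neq0 (pow2_gt0 R _)).
Qed.

Lemma branch_bounds c (u : R) : 0 <= u <= 1 ->
  sub_at R 0 c <= sub_at R 0 c + u / 2 ^+ (entry 1 c + 2) <= sub_at R 1 c.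
Proof.
move=> /andP[u0 u1]; rewrite lerDl divr_ge0 ?(ltW (pow2_gt0 R _)) //=.
rewrite /sub_at addn0 natrD mulrDl lerD2l mulr1n.
by rewrite ler_pM2r ?invr_gt0 ?pow2_gt0.
Qed.

Lemma branch_cvg d c (u : R) :
  (forall l, (binary d l)%:R / 2 ^+ l <= u <= (binary d l).+1%:R / 2 ^+ l) ->
  branch_at d c l @[l --> \oo] --> sub_at R 0 c + u / 2 ^+ (entry 1 c + 2).
Proof.
move=> /binary_cvg Hu; apply: cvgD; first exact: cvg_cst.
by apply: cvgM => //; exact: cvg_cst.
Qed.

Lemma binary_unit (d : nat -> bool) l : 0 <= (binary d l)%:R / (2 ^+ l : R) <= 1.
Proof.
rewrite divr_ge0 ?(ltW (pow2_gt0 R _)) //=; have [u Hu] := binary_bracket d.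
have /andP[lu _] := Hu l; apply: le_trans lu _.
by have /andP[_] := Hu 0%N; rewrite /binary /= expr0 divr1.
Qed.

Lemma within_cvg (h : R -> R) (q : nat -> R) (z : R) :
  {within unit_itv R, continuous h} -> (forall l, unit_itv R (q l)) ->
  unit_itv R z -> q l @[l --> \oo] --> z -> h (q l) @[l --> \oo] --> h z.
Proof.
move=> /subspace_continuousP hc q1 z1 qz.
apply: (cvg_comp _ _ _ (hc z z1)) => P /= Pz; have := qz _ Pz.
by apply: (@filterS _ \oo _ [set l | _]) => l Pl; exact: Pl (q1 l).
Qed.

End Analysis.

Section LimitTest.
Variable R : realType.
Variables (X Y : interp (tR ->> tN)) (A : set R) (y : R -> nat) (n c : nat) (x : R).
Hypotheses (XA : represents_set X A) (Yy : represents_natfun Y y)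
  (yinj : {in A &, injective y}) (c01 : @coded_itv R c `<=` unit_itv R)
  (Ax : A x) (yx : y x = n).
Variable Psi : interp limit_type.
Hypothesis HPsi : limit_functional R Psi.
Local Notation F := (slices X Y n).

Lemma limit_test_code (g : nat -> nat) L :
  limit_test Psi F c (CodeSeq.code (mkseq g L)) =
  [&& entry 0 L + entry 1 L < L, g 0 <= entry 0 L, g (entry 0 L) <= entry 1 L,
      g (entry 0 L + entry 1 L) < L &
    ~~ above_half (Psi F (fun=> F) (entry 0 L) (entry 1 L)
         (fun=> branch_point (odd \o g) c L) 2)]%N.
Proof.
have entryE i : (i < L)%N -> entry i (CodeSeq.code (mkseq g L)) = g i.
  by move=> iL; rewrite /entry CodeSeq.codeK nth_mkseq.
rewrite /limit_test CodeSeq.codeK size_mkseq; case: ltnP => //= nmL.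
have [zL nL] : (0 < L)%N /\ (entry 0 L < L)%N by lia.
rewrite !entryE //.
suff -> : branch_point (odd \o entry^~ (CodeSeq.code (mkseq g L))) c L =
  branch_point (odd \o g) c L by [].
by rewrite /branch_point (eq_binary (d' := odd \o g)) // => i iL /=; rewrite entryE.
Qed.

Lemma S2_limit_test : (S2 1 (limit_test Psi F c) = 0)%N <->
  exists g, forall L, limit_test Psi F c (CodeSeq.code (mkseq g L)) = 0%N.
Proof. by rewrite /S2; case: asboolP. Qed.

(** The list i, m, B + (i + m) has a code exceeding its items. *)
Lemma infinitely_often i m B : exists L, [/\ (B < L)%N, (i + m < L)%N,
  entry 0 L = i & entry 1 L = m].
Proof.
exists (CodeSeq.code [:: i; m; B + (i + m)]%N); rewrite /entry CodeSeq.codeK.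
have /and4P[_ _ lt_B _] := CodeSeq.ltn_code [:: i; m; B + (i + m)]%N.
by split=> //; apply: leq_ltn_trans lt_B; rewrite ?leq_addr ?leq_addl.
Qed.

Lemma leq_term_sum (f : nat -> nat) i k : (i < k)%N -> (f i <= \sum_(a < k) f a)%N.
Proof. by move=> ik; rewrite (bigD1 (Ordinal ik)) //= leq_addr. Qed.

(** Write h i m for the continuous functions and z for the point described by a
    witness.  If z is not in the slice, then h i m (z) < 1/4 for some i and m
    beyond the bounds of the witness, and by continuity the same holds at almost
    all approximations of z; at a length that tests i, m the witness fails.
    Conversely, if x lies in the first quarter, then h i m (x) > 3/4 eventually,
    and the bounds for the three limits i, m and l are combined into the
    values of a single function, whose parities are the digits of x. *)
Lemma S2_limit_testP :
  (S2 1 (limit_test Psi F c) == 0)%N = (x \in `[sub_at R 0 c, sub_at R 1 c]).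
Proof.
have Frep := slices_represents n XA Yy.
have [h [Hh /(_ (fun z _ => slice_unit _ _ _ _) (slice_baire2 n yinj))]] :=
  HPsi Frep (fun=> Frep).
move=> [hc hlim]; pose q d l : R := branch_at R d c l.
have fE := slice_at yinj Ax yx.
have q01 d l : unit_itv R (q d l).
  apply: c01; have := branch_bounds c (binary_unit R d l).
  rewrite /coded_itv /= in_itv /= -sub_at0 -sub_at4 => /andP[-> /le_trans]; apply.
  exact: sub_at_le.
have err i m d l : `|rat_of_code R (Psi F (fun=> F) i m
    (fun=> branch_point d c l) 2%N) - h i m (q d l)| <= 4^-1.
  have := represents_err 2 (Hh i m _ _ (branch_represents R d c l)).
  by rewrite (_ : 2 ^- 2 = 4^-1 :> R) // -natrX.
apply/eqP/idP => [/S2_limit_test [g Hg]|xin].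
  have [u Hu] := binary_bracket R (odd \o g).
  have qz := @branch_cvg R (odd \o g) c u Hu; set z := _ + _ in qz.
  have zin : z \in `[sub_at R 0 c, sub_at R 1 c].
    rewrite in_itv /=; apply: branch_bounds.
    by have := Hu 0%N; rewrite /binary /= expr0 !divr1.
  case: (eqVneq z x) => [<- //|zx]; exfalso.
  have z1 : unit_itv R z.
    apply: c01; move: zin; rewrite /coded_itv /= !in_itv /= sub_at0 -sub_at4.
    by move=> /andP[-> /le_trans]; apply; exact: sub_at_le.
  have [l [hl lf]] := hlim z z1; rewrite fE (negbTE zx) in lf.
  have small (v : nat -> R) (b : R) : v k @[k --> \oo] --> b -> b < 4^-1 ->
      exists N, forall k, (N <= k)%N -> v k < 4^-1.
    move=> vb b4; have [N _ HN] : \forall k \near \oo, v k < 4^-1.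
      exact: vb _ (open_nbhs_nbhs (conj (@open_lt R 4^-1) b4)).
    by exists N => k Nk; exact: HN.
  (* The limits are taken in turn: first i, then m, then the length L. *)
  have [|N HN] := small _ _ lf; first by rewrite invr_gt0.
  have [M HM] := small _ _ (hl (N + g 0)%N) (HN _ (leq_addr _ _)).
  set i := (N + g 0)%N in HM; pose m := (M + g i)%N.
  have [B HB] := small _ _ (within_cvg (hc i m) (q01 (odd \o g)) z1 qz)
    (HM m (leq_addr _ _)).
  have [L [BL imL L0 L1]] := infinitely_often i m (B + g (i + m)%N).
  have := Hg L; rewrite limit_test_code L0 L1 imL !leq_addl /=.
  rewrite (leq_ltn_trans (leq_addl _ _) BL) (above_halfP R) /=.
  have := HB L (ltnW (leq_ltn_trans (leq_addr _ _) BL)).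
  have := err i m (odd \o g) L; rewrite ler_distl => /andP[_ hi] lo.
  by have /negbTE -> // : ~~ (2^-1 < rat_of_code R (Psi F (fun=> F) i m
    (fun=> branch_point (odd \o g) c L) 2%N)); rewrite -leNgt; lra.
apply/S2_limit_test.
have [d Hd] : exists d, forall l, (binary d l)%:R / 2 ^+ l <=
    (x - sub_at R 0 c) * 2 ^+ (entry 1 c + 2) <= (binary d l).+1%:R / 2 ^+ l.
  apply: binary_expansion; move: xin; rewrite in_itv /= => /andP[x0 x1].
  rewrite mulr_ge0 ?subr_ge0 ?(ltW (pow2_gt0 R _)) //=.
  rewrite -ler_pdivlMr ?pow2_gt0 // lerBlDl; apply: le_trans x1 _.
  by rewrite /sub_at addn0 natrD mulrDl mulr1n mul1r.
have := @branch_cvg R d c _ Hd; rewrite mulfK ?lt0r_neq0 ?pow2_gt0 // subrKC => qx.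
have x1 : unit_itv R x.
  apply: c01; move: xin; rewrite /coded_itv /= !in_itv /= sub_at0 -sub_at4.
  by move=> /andP[-> /le_trans]; apply; exact: sub_at_le.
have [l [hl lf]] := hlim x x1; rewrite fE eqxx in lf.
have big (v : nat -> R) (b : R) : v k @[k --> \oo] --> b -> 3 / 4 < b ->
    exists N, forall k, (N <= k)%N -> 3 / 4 < v k.
  move=> vb b4; have [N _ HN] : \forall k \near \oo, 3 / 4 < v k.
    exact: vb _ (open_nbhs_nbhs (conj (@open_gt R (3 / 4)) b4)).
  by exists N => k Nk; exact: HN.
have [|N HN] := big _ _ lf; first by rewrite ltr_pdivrMr // mul1r ltr_nat.
have /boolp.choice [M HM] i : exists Mi, (N <= i)%N ->
    forall m, (Mi <= m)%N -> 3 / 4 < h i m x.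
  have [Ni|_] := leqP N i; last by exists 0%N.
  by have [Mi HMi] := big _ _ (hl i) (HN i Ni); exists Mi.
have /boolp.choice [I HI] (im : nat * nat) : exists Ii, (N <= im.1)%N ->
    (M im.1 <= im.2)%N -> forall L, (Ii <= L)%N -> 3 / 4 < h im.1 im.2 (q d L).
  case: im => i m /=; have [Ni|_] := leqP N i; last by exists 0%N.
  have [Mm|_] := leqP (M i) m; last by exists 0%N.
  have [Ii HIi] := big _ _ (within_cvg (hc i m) (q01 d) x1 qx) (HM i Ni m Mm).
  by exists Ii.
(* s j bounds all the thresholds needed for the indices up to j; doubling it
   leaves room for the digit. *)
pose s j := (N + \sum_(a < j.+1) M a
  + \sum_(a < j.+1) \sum_(b < j.+1) I (a : nat, b : nat))%N.
pose g j := ((s j).*2 + d j)%N.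
have gd : odd \o g = d.
  by apply/funext => j; rewrite /g /= oddD odd_double; case: (d j).
have sg j : (s j <= g j)%N by rewrite /g -addnn -addnA leq_addr.
exists g => L; rewrite limit_test_code gd.
set i := entry 0 L; set m := entry 1 L.
case: ltnP => //= imL; case: (leqP (g 0%N) i) => //= gi.
case: (leqP (g i) m) => //= gm; case: (ltnP (g (i + m)%N) L) => //= gL.
 apply/eqP; rewrite eqb0 negbK (above_halfP R).
have Ni : (N <= i)%N.
  apply: leq_trans gi; apply: leq_trans (sg 0%N). 
  by rewrite /s -addnA leq_addr.
have Mm : (M i <= m)%N.
  apply: leq_trans gm; apply: leq_trans (sg i); rewrite /s addnAC.
  by apply: leq_trans (leq_addl _ _); exact: leq_term_sum (ltnSn i).
have IL : (I (i, m) <= L)%N.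
  apply: ltnW; apply: leq_ltn_trans gL; apply: leq_trans (sg _); rewrite /s.
  apply: leq_trans (leq_addl _ _).
  apply: leq_trans (leq_term_sum (fun a => \sum_(b < _) I (a, b : nat)) (_ : i < _)%N).
    by apply: (leq_term_sum (fun b => I (i, b))); rewrite ltnS leq_addl.
  by rewrite ltnS leq_addr.
have := HI (i, m) Ni Mm L IL; have := err i m d L.
by rewrite ler_distl /= => /andP[lo _] hi; lra.
Qed.

Lemma limit_step_avoids : ~ @coded_itv R (limit_step Psi F c) x.
Proof. by apply: quarter_avoids; exact: S2_limit_testP. Qed.
End LimitTest.

Local Close Scope ring_scope.
Local Close Scope classical_set_scope.

(** * The realisers and their oracles *)

Section Main.
Variable R : realType.

Lemma sup_realiser Phi : sup_functional R Phi ->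
  cantor_realiser R (fun X Y => nested_rep (fun n => sup_step Phi (slices X Y n))).
Proof.
move=> HPhi; apply: realiser_of_step => [X Y n c|X A Y y n c x XA Yy yinj c01 Ax yx].
  exact: refines_quarter.
exact: (sup_step_avoids XA Yy yinj c01 Ax yx HPhi).
Qed.

Lemma limit_realiser Psi : limit_functional R Psi ->
  cantor_realiser R (fun X Y => nested_rep (fun n => limit_step Psi (slices X Y n))).
Proof.
move=> HPsi; apply: realiser_of_step => [X Y n c|X A Y y n c x XA Yy yinj c01 Ax yx].
  exact: refines_quarter.
exact: (limit_step_avoids XA Yy yinj c01 Ax yx HPsi).
Qed.

Lemma modulus_realiser Xi : modulus_functional R Xi ->
  cantor_realiser R (fun X Y => nested_rep (fun n => modulus_step Xi (slices X Y n))).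
Proof.
move=> HXi; apply: realiser_of_step => [X Y n c|X A Y y n c x XA Yy yinj c01 Ax yx].
  exact: refines_modulus_step.
exact: (modulus_step_avoids XA Yy yinj c01 Ax yx HXi).
Qed.

Lemma eq_nested_rep (step : interp (tR ->> tR) -> nat -> nat)
    (F F' : nat -> interp (tR ->> tR)) :
  (forall n c, step (F n) c = step (F' n) c) ->
  nested_rep (fun n => step (F n)) = nested_rep (fun n => step (F' n)).
Proof.
move=> eq_step; congr nested_rep; apply/funext => n; apply/funext => c.
exact: eq_step.
Qed.

(** The oracle G occurs in the computations as one more fixed object, besides
    the indicators and constant functions at which Phi is called. *)
Lemma sup_not_computable (G : interp ((tN ->> tN) ->> tN)) Phi :
  sup_functional R Phi -> ~ computable_in [:: obj G] Phi.
Proof.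
move=> HPhi [e He].
pose T (F : nat -> interp (tR ->> tR)) (i : nat * nat * nat) :=
  Phi (F i.1.1) (fun=> F i.1.1) (fun=> i.1.2) (fun=> i.2) 2.
apply: (@no_computable_realiser R G (fun F => nested_rep (fun n => sup_step Phi (F n)))
  _ T (fun=> e) (fun i => [:: (0, 0); (1, i.1.1); (2, i.1.1); (4, i.1.2);
    (4, i.2); (3, 2)])).
- move=> X Y i; set F := slices X Y i.1.1.
  exact: (He (F, (fun=> F, (fun=> i.1.2, (fun=> i.2, (2, tt)))))).
- move=> F F' TE; apply: (eq_nested_rep (step := sup_step Phi)) => n c.
  by rewrite /sup_step; have := TE (n, subpoint 0 c, subpoint 1 c); rewrite /T /= => ->.
- exact: sup_realiser.
Qed.

Lemma limit_not_computable (G : interp ((tN ->> tN) ->> tN)) Psi :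
  limit_functional R Psi -> ~ computable_in [:: obj G] Psi.
Proof.
move=> HPsi [e He].
pose T (F : nat -> interp (tR ->> tR)) (i : nat * nat * nat * nat) :=
  Psi (F i.1.1.1) (fun=> F i.1.1.1) i.1.1.2 i.1.2 (fun=> i.2) 2.
apply: (@no_computable_realiser R G
  (fun F => nested_rep (fun n => limit_step Psi (F n)))
  _ T (fun=> e) (fun i => [:: (0, 0); (1, i.1.1.1); (2, i.1.1.1); (3, i.1.1.2);
    (3, i.1.2); (4, i.2); (3, 2)])).
- move=> X Y i; set F := slices X Y i.1.1.1.
  exact: (He (F, (fun=> F, (i.1.1.2, (i.1.2, (fun=> i.2, (2, tt))))))).
- move=> F F' TE; apply: (eq_nested_rep (step := limit_step Psi)) => n c.
  rewrite /limit_step; congr (quarter (S2 1 _ == 0) c); apply/funext => sigma.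
  rewrite /limit_test; set i := entry 0 _; set m := entry 1 _.
  set p := branch_point _ _ _.
  by have := TE (n, i, m, p); rewrite /T /= => ->.
- exact: limit_realiser.
Qed.

(** A step calls Xi and, to choose its centre, the indicator itself; S8 with
    constant arguments computes the latter. *)
Lemma modulus_not_computable (G : interp ((tN ->> tN) ->> tN)) Xi :
  modulus_functional R Xi -> ~ computable_in [:: obj G] Xi.
Proof.
move=> HXi [e He].
pose T (F : nat -> interp (tR ->> tR)) (i : bool * nat * nat) :=
  if i.1.1 then Xi (F i.1.2) (fun=> F i.1.2) (fun=> i.2) 0
  else F i.1.2 (fun=> i.2) 0.
apply: (@no_computable_realiser R G
  (fun F => nested_rep (fun n => modulus_step Xi (F n))) _ T
  (fun i => if i.1.1 then e else CodeSeq.code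
    [:: 8; CodeSeq.code [:: 2; i.2]; CodeSeq.code [:: 2; 0]])
  (fun i => if i.1.1 then [:: (0, 0); (1, i.1.2); (2, i.1.2); (4, i.2); (3, 0)]
    else [:: (1, i.1.2)])).
- move=> X Y [[[] n] p]; rewrite /T /=; set F := slices X Y n.
    exact: (He (F, (fun=> F, (fun=> p, (0, tt))))).
  apply: (@kleene_S8 [:: _; _] (tR ->> tR) F (fun=> p, (0, tt))).
  apply: kleene_args_cons => [xi|]; first exact: kleene_S2.
  apply: kleene_args_cons => [xi|]; first exact: kleene_S2.
  exact: kleene_args_nil.
- move=> F F' TE; apply: (eq_nested_rep (step := modulus_step Xi)) => n c.
  rewrite /modulus_step; have := TE (false, n, subpoint 1 c); rewrite /T /= => ->.
  by have := TE (true, n, dyadic_code (4 * entry 0 c + 1 + F' n (fun=> subpoint 1 c) 0)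
    (entry 1 c + 2)); rewrite /T /= => ->.
- exact: modulus_realiser.
Qed.

End Main.

Theorem theorem2p10 (R : realType) :
  ((forall k : nat, (1 <= k)%N -> forall Phi,
      sup_functional R Phi -> ~ computable_in [:: obj (S2 k)] Phi) /\
   (forall k : nat, (1 <= k)%N -> forall Psi,
      limit_functional R Psi -> ~ computable_in [:: obj (S2 k)] Psi) /\
   (forall k : nat, (1 <= k)%N -> forall Xi,
      modulus_functional R Xi -> ~ computable_in [:: obj (S2 k)] Xi)) /\
  ((forall Phi, sup_functional R Phi ->
      exists C, cantor_realiser R C /\
        computable_in [:: obj Phi; obj (S2 1)] C) /\
   (forall Psi, limit_functional R Psi ->
      exists C, cantor_realiser R C /\
        computable_in [:: obj Psi; obj (S2 1)] C) /\
   (forall Xi, modulus_functional R Xi ->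
      exists C, cantor_realiser R C /\
        computable_in [:: obj Xi; obj (S2 1)] C)).
Proof.
split; split; [|split| |split].
- by move=> k _ Phi; exact: sup_not_computable.
- by move=> k _ Psi; exact: limit_not_computable.
- by move=> k _ Xi; exact: modulus_not_computable.
- move=> Phi HPhi.
  exists (fun X Y => nested_rep (fun n => sup_step Phi (slices X Y n))).
  split; first exact: sup_realiser.
  apply: computes_realiser => E ctx X Y n c cPhi _; exact: computes_sup_step.
- move=> Psi HPsi.
  exists (fun X Y => nested_rep (fun n => limit_step Psi (slices X Y n))).
  split; first exact: limit_realiser.
  apply: computes_realiser => E ctx X Y n c; exact: computes_limit_step.
- move=> Xi HXi.
  exists (fun X Y => nested_rep (fun n => modulus_step Xi (slices X Y n))).
  split; first exact: modulus_realiser.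
  apply: computes_realiser => E ctx X Y n c cXi _; exact: computes_modulus_step.
Qed.
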